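(* There exists an absolute constant $\gamma_0>0$ such that $\mathcal{M}_8(\Sigma)>\gamma_0$ for every admissible surface $\Sigma\in\mathscr{A}$.
   Context: $B(x,r)$ denotes the closed ball of radius $r$ centered at $x\in\mathbb{R}^3$. For $\varphi\in(0,\pi/2)$ and $w\in\mathbb{S}^2$ put $C^{\pm}(\varphi,w)=\{y\in\mathbb{R}^3:\pm\,y\cdot w\ge|y|\cos\varphi\}$. The class $\mathscr{A}$ of admissible surfaces consists of all compact connected sets $\Sigma\subset\mathbb{R}^3$ with $\Sigma=\partial U$ for some bounded domain $U\subset\mathbb{R}^3$ such that: (i) there is a constant $K=K(\Sigma)$ with $\infty>\mathcal{H}^2(\Sigma\cap B(x,r))\ge K^{-1}r^2$ for all $x\in\Sigma$ and $0<r\le\operatorname{diam}\Sigma$; (ii) there is a dense subset $\Sigma^\ast\subset\Sigma$ such that for each $x\in\Sigma^\ast$ there are $v=v(x)\in\mathbb{S}^2$ and $\delta_0=\delta_0(x)>0$ with $B(x,\delta_0)\cap(x+C^+(\pi/4,v))\subset U\cup\{x\}$ and $B(x,\delta_0)\cap(x+C^-(\pi/4,v))\subset(\mathbb{R}^3\setminus\overline U)\cup\{x\}$. For a tetrahedron $T=(x_0,x_1,x_2,x_3)\in(\mathbb{R}^3)^4$ put $\mathcal{K}(T)=\dfrac{V(T)}{A(T)(\operatorname{diam}T)^2}$ if the four vertices are not co-planar, and $\mathcal{K}(T)=0$ otherwise, where $V(T)$ is the volume of $T$ and $A(T)$ is the sum of the areas of its four triangular faces. The integral Menger curvature is $\mathcal{M}_p(\Sigma)=\int_{\Sigma}\int_\Sigma\int_\Sigma\int_\Sigma\mathcal{K}^p(x_0,x_1,x_2,x_3)\,d\mathcal{H}^2(x_0)\,d\mathcal{H}^2(x_1)\,d\mathcal{H}^2(x_2)\,d\mathcal{H}^2(x_3)$,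 with $\mathcal{H}^2$ the two-dimensional Hausdorff measure; here $p=8$. *)

(* Defs.v *)
From HB Require Import structures.
From mathcomp Require Import all_boot all_order all_algebra.
From mathcomp Require Import all_classical all_reals all_analysis.

Set Implicit Arguments.
Unset Strict Implicit.
Unset Printing Implicit Defensive.
Import Order.TTheory GRing.Theory Num.Theory.
Import numFieldNormedType.Exports.

Local Open Scope classical_set_scope.
Local Open Scope ring_scope.

(** The topology that the library puts on row
    vectors is the usual one, but its norm is the sup norm, so the Euclidean
    norm and the Euclidean balls are introduced here. *)

Definition dot3 (R : realType) (u v : 'rV[R]_3) : R :=
  \sum_(i < 3) u ord0 i * v ord0 i.

Definition enorm (R : realType) (u : 'rV[R]_3) : R := Num.sqrt (dot3 u u).

Definition cross3 (R : realType) (u v : 'rV[R]_3) : 'rV[R]_3 :=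
  \row_(i < 3) (u ord0 (ordS i) * v ord0 (ordS (ordS i))
                - u ord0 (ordS (ordS i)) * v ord0 (ordS i)).

Definition eball (R : realType) (x : 'rV[R]_3) (r : R) : set 'rV[R]_3 :=
  [set y | enorm (y - x) <= r].

Definition cone_pos (R : realType) (phi : R) (w : 'rV[R]_3) : set 'rV[R]_3 :=
  [set y | dot3 y w >= enorm y * cos phi].

Definition cone_neg (R : realType) (phi : R) (w : 'rV[R]_3) : set 'rV[R]_3 :=
  [set y | - dot3 y w >= enorm y * cos phi].

Definition translate (R : realType) (x : 'rV[R]_3) (A : set 'rV[R]_3) :
  set 'rV[R]_3 := [set x + y | y in A].

Definition boundary (T : topologicalType) (A : set T) : set T :=
  closure A `\` interior A.

(** The point 0 is included so that [diam set0 = 0]. *)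
Definition diam (R : realType) (A : set 'rV[R]_3) : \bar R :=
  ereal_sup ([set 0%E] `|`
             [set (enorm (z.1 - z.2))%:E | z in A `*` A]).

(** The two-dimensional Hausdorff (outer) measure, with the normalization
    [omega_2 * (diam / 2) ^ 2], where [omega_2 = pi] is the area of the unit
    disc, that makes it agree with the area on planes. *)

Section hausdorff2_def.
Local Open Scope ereal_scope.
Context {R : realType}.

Definition hausdorff2_cover (delta : R) (A : set 'rV[R]_3) :
    set ((set 'rV[R]_3)^nat) :=
  [set F | (forall k, diam (F k) <= delta%:E) /\ A `<=` \bigcup_k F k].

Definition hausdorff2_delta (delta : R) (A : set 'rV[R]_3) : \bar R :=
  ereal_inf [set \sum_(k <oo) (pi / 4)%:E * diam (F k) ^+ 2
            | F in hausdorff2_cover delta A].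

Definition hausdorff2 (A : set 'rV[R]_3) : \bar R :=
  ereal_sup [set hausdorff2_delta delta A | delta in [set d : R | (0 < d)%R]].

End hausdorff2_def.

Section hausdorff2_outer_measure.
Local Open Scope ereal_scope.
Context (R : realType).
Implicit Types (A B : set 'rV[R]_3) (delta : R).

Lemma diam_ge0 A : 0 <= diam A.
Proof. by apply: ereal_sup_ubound; left. Qed.

Lemma diam0 : diam (set0 : set 'rV[R]_3) = 0.
Proof.
apply/eqP; rewrite eq_le diam_ge0 andbT.
by apply: ge_ereal_sup => _ [->//|[z [] []]].
Qed.

Let zeta A : \bar R := (pi / 4)%:E * diam A ^+ 2.

Let zeta_ge0 A : 0 <= zeta A.
Proof.
apply: mule_ge0; last exact/expe_ge0/diam_ge0.
by rewrite lee_fin divr_ge0// pi_ge0.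
Qed.

Let zeta0 : zeta set0 = 0.
Proof. by rewrite /zeta diam0 expe2 mule0 mule0. Qed.

Lemma hausdorff2_delta_ge0 delta A : 0 <= hausdorff2_delta delta A.
Proof.
apply: le_ereal_inf_tmp => _ [F _ <-]; apply: nneseries_ge0 => n _ _.
exact: zeta_ge0.
Qed.

Lemma hausdorff2_delta0 delta : (0 < delta)%R -> hausdorff2_delta delta set0 = 0.
Proof.
move=> d0; apply/eqP; rewrite eq_le hausdorff2_delta_ge0 andbT.
apply: ereal_inf_lbound; exists (fun=> set0).
  by split => // k; rewrite diam0 lee_fin ltW.
by apply: eseries0 => k _ _; exact: zeta0.
Qed.

Lemma le_hausdorff2_delta delta :
  {homo @hausdorff2_delta R delta : A B / A `<=` B >-> A <= B}.
Proof.
move=> A B AB; apply/ereal_inf_le_tmp => _ [F [dF BF] <-].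
by exists F => //; split => //; exact: subset_trans BF.
Qed.

Lemma hausdorff2_delta_sigma_subadditive delta :
  sigma_subadditive (@hausdorff2_delta R delta).
Proof.
move=> A.
have [[i ioo]|] := pselect (exists i, hausdorff2_delta delta (A i) = +oo).
  rewrite (eseries_pinfty _ _ ioo) ?leey// => n _.
  by rewrite -ltNye (lt_le_trans _ (hausdorff2_delta_ge0 _ _)).
rewrite -forallNE => Aoo.
suff add2e (e : {posnum R}) : hausdorff2_delta delta (\bigcup_n A n) <=
    \sum_(i <oo) hausdorff2_delta delta (A i) + e%:num%:E.
  by apply/lee_addgt0Pr => _/posnumP[].
rewrite (le_trans _ (epsilon_trick _ _ _))//; last first.
  by move=> n; exact: hausdorff2_delta_ge0.
pose P n (B : (set 'rV[R]_3)^nat) := hausdorff2_cover delta (A n) B /\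
  \sum_(k <oo) zeta (B k)
    <= hausdorff2_delta delta (A n) + (e%:num / (2 ^ n.+1)%:R)%:E.
have [G PG] : {G : ((set 'rV[R]_3)^nat)^nat & forall n, P n (G n)}.
  apply: (@choice _ _ P) => n; rewrite /P /hausdorff2_delta.
  set S := (X in ereal_inf X); move infS : (ereal_inf S) => iS.
  case: iS infS => [r Sr|Soo|Soo].
  - have en1 : (0 < e%:num / (2 ^ n.+1)%:R)%R by [].
    have /(lb_ereal_inf_adherent en1) : ereal_inf S \is a fin_num by rewrite Sr.
    move=> [x [B [mB AnB muBx] xS]].
    by exists B; split => //; rewrite muBx -Sr; exact/ltW.
  - by have := Aoo n; rewrite /hausdorff2_delta Soo.
  - suff : lbound S 0 by move/le_ereal_inf_tmp; rewrite Soo.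
    by move=> /= _ [B [mB AnB] <-]; apply: nneseries_ge0 => k _ _; exact: zeta_ge0.
have zG_ge0 x : 0 <= (zeta \o uncurry G) x by exact: zeta_ge0.
apply: (@le_trans _ _ (\esum_(i in setT) (zeta \o uncurry G) i)).
  apply: ereal_inf_lbound => /=.
  have /card_esym/ppcard_eqP[f] := card_nat2.
  exists (uncurry G \o f).
    split => [i|]; first by rewrite /=; case: (f i) => a b; exact: (PG a).1.1.
    move=> t [i _ /(PG i).1.2 [j _ ?]].
    by exists (f^-1%FUN (i, j)) => //=; rewrite invK ?inE.
  rewrite -(esum_pred_image (zeta \o uncurry G) _ xpredT) ?[fun=> _]set_true//.
  by rewrite image_eq.
rewrite (_ : esum _ _ = \sum_(i <oo) \sum_(j <oo ) zeta (G i j)); last first.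
  pose J : nat -> set (nat * nat) := fun i => [set (i, j) | j in setT].
  rewrite (_ : setT = \bigcup_k J k); last first.
    by rewrite predeqE => -[a b]; split => // _; exists a => //; exists b.
  rewrite esum_bigcupT /=; last 2 first.
    - apply/trivIsetP => i j _ _ ij.
      rewrite predeqE => -[n m] /=; split => //= -[] [_] _ [<-{n} _].
      by move=> [m' _] [] /esym/eqP; rewrite (negbTE ij).
    - by move=> /= [n m]; exact: zeta_ge0.
  rewrite -(image_id [set: nat]) -fun_true esum_pred_image//; last first.
    by move=> n _; exact: esum_ge0.
  apply: eq_eseriesr => /= j _.
  rewrite -(esum_pred_image (zeta \o uncurry G) (pair j) predT)//=; last first.
    by move=> ? ? _ _; exact: (@can_inj _ _ _ snd).
  by congr esum; rewrite predeqE => -[a b]; split; move=> [i _ <-]; exists i.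
apply: lee_lim.
- apply: is_cvg_nneseries => n *.
  by apply: nneseries_ge0 => m *; exact: (zG_ge0 (n, m)).
- by apply: is_cvg_nneseries => n *; apply: adde_ge0 => //;
    exact: hausdorff2_delta_ge0.
- by near=> n; apply: lee_sum => i _; exact: (PG i).2.
Unshelve. all: by end_near. Qed.

Lemma hausdorff2_0 : hausdorff2 (set0 : set 'rV[R]_3) = 0.
Proof.
apply/eqP; rewrite eq_le; apply/andP; split.
  by apply: ge_ereal_sup => _ [d d0 <-]; rewrite hausdorff2_delta0.
rewrite -(hausdorff2_delta0 ltr01).
by apply: ereal_sup_ubound; exists 1%R => //=.
Qed.

Lemma hausdorff2_ge0 A : 0 <= hausdorff2 A.
Proof.
apply: le_trans (hausdorff2_delta_ge0 1 A) _.
by apply: ereal_sup_ubound; exists 1%R => //=.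
Qed.

Lemma le_hausdorff2 : {homo @hausdorff2 R : A B / A `<=` B >-> A <= B}.
Proof.
move=> A B AB; apply: ge_ereal_sup => _ [d d0 <-].
apply: le_trans (le_hausdorff2_delta d AB) _.
by apply: ereal_sup_ubound; exists d.
Qed.

Lemma hausdorff2_sigma_subadditive : sigma_subadditive (@hausdorff2 R).
Proof.
move=> F; apply: ge_ereal_sup => _ [d d0 <-].
apply: le_trans (hausdorff2_delta_sigma_subadditive d F) _.
apply: lee_nneseries => [k _ _|k _]; first exact: hausdorff2_delta_ge0.
by apply: ereal_sup_ubound; exists d.
Qed.

HB.instance Definition _ := isOuterMeasure.Build R 'rV[R]_3 (@hausdorff2 R)
  hausdorff2_0 hausdorff2_ge0 le_hausdorff2 hausdorff2_sigma_subadditive.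

End hausdorff2_outer_measure.

Definition hausdorff2_outer (R : realType) :
  {outer_measure set 'rV[R]_3 -> \bar R} := @hausdorff2 R.

(** R^3 equipped with the sigma-algebra of the sets that are measurable for the
    outer measure [hausdorff2] in the sense of Caratheodory; on it,
    [hausdorff2] is a measure. *)
Notation R3_H2 R := (caratheodory_type (hausdorff2_outer R)).

Definition hausdorff2_measure (R : realType) :
    {measure set (R3_H2 R) -> \bar R} :=
  hausdorff2_outer R : set (R3_H2 R) -> \bar R.

Definition coplanar (R : realType) (x0 x1 x2 x3 : 'rV[R]_3) : Prop :=
  exists (n : 'rV[R]_3) (c : R), n != 0 /\
    [/\ dot3 n x0 = c, dot3 n x1 = c, dot3 n x2 = c & dot3 n x3 = c].

Definition tetra_volume (R : realType) (x0 x1 x2 x3 : 'rV[R]_3) : R :=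
  `|dot3 (x3 - x0) (cross3 (x1 - x0) (x2 - x0))| / 6.

Definition triangle_area (R : realType) (a b c : 'rV[R]_3) : R :=
  enorm (cross3 (b - a) (c - a)) / 2.

Definition tetra_area (R : realType) (x0 x1 x2 x3 : 'rV[R]_3) : R :=
  triangle_area x0 x1 x2 + triangle_area x0 x1 x3
  + triangle_area x0 x2 x3 + triangle_area x1 x2 x3.

(** A simplex has the same diameter as its set of vertices. *)
Definition tetra_diam (R : realType) (x0 x1 x2 x3 : 'rV[R]_3) : R :=
  fine (diam [set x0; x1; x2; x3]).

Definition menger_curvature (R : realType) (x0 x1 x2 x3 : 'rV[R]_3) : R :=
  if `[< coplanar x0 x1 x2 x3 >] then 0
  else tetra_volume x0 x1 x2 x3
       / (tetra_area x0 x1 x2 x3 * tetra_diam x0 x1 x2 x3 ^+ 2).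

Definition integral_menger (R : realType) (p : R) (Sigma : set 'rV[R]_3) :
    \bar R :=
  (\int[hausdorff2_measure R]_(x3 in (Sigma : set (R3_H2 R)))
   \int[hausdorff2_measure R]_(x2 in (Sigma : set (R3_H2 R)))
   \int[hausdorff2_measure R]_(x1 in (Sigma : set (R3_H2 R)))
   \int[hausdorff2_measure R]_(x0 in (Sigma : set (R3_H2 R)))
     ((menger_curvature x0 x1 x2 x3) `^ p)%:E)%E.

(** The library counts the empty set as connected; a domain is nonempty. *)
Definition is_domain (R : realType) (U : set 'rV[R]_3) : Prop :=
  [/\ U !=set0, open U & connected U].

Definition ahlfors_lower (R : realType) (Sigma : set 'rV[R]_3) : Prop :=
  exists2 K : R, 0 < K &
    forall (x : 'rV[R]_3) (r : R),
      Sigma x -> 0 < r -> (r%:E <= diam Sigma)%E ->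
      ((K^-1 * r ^+ 2)%:E <= hausdorff2 (Sigma `&` eball x r) < +oo)%E.

Definition dense_cone_condition (R : realType) (Sigma U : set 'rV[R]_3) : Prop :=
  exists Sigma' : set 'rV[R]_3,
    [/\ Sigma' `<=` Sigma, Sigma `<=` closure Sigma' &
      forall x, Sigma' x ->
        exists (v : 'rV[R]_3) (delta0 : R),
          [/\ enorm v = 1, 0 < delta0,
            eball x delta0 `&` translate x (cone_pos (pi / 4) v)
              `<=` U `|` [set x] &
            eball x delta0 `&` translate x (cone_neg (pi / 4) v)
              `<=` ~` closure U `|` [set x]]].

Definition admissible (R : realType) (Sigma : set 'rV[R]_3) : Prop :=
  [/\ compact Sigma, connected Sigma &
    exists U : set 'rV[R]_3,
      [/\ is_domain U, bounded_set U, Sigma = boundary U,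
          ahlfors_lower Sigma & dense_cone_condition Sigma U]].

(* Main.v *)
Require Import Defs.
From mathcomp Require Import all_boot all_order all_algebra.
From mathcomp Require Import all_classical all_reals all_analysis.
From mathcomp Require Import measurable_realfun ring lra.

(** Let Sigma be the boundary of the bounded open set U. Call a point x
    two-sided at scale r if, for some unit vector v, the ball of radius r about
    x + 2rv lies in U while its mirror image about x lies outside U. The proof
    looks at the scale at which a point ceases to be two-sided.

    Two-sidedness gives area: each segment parallel to v that joins the two
    balls crosses Sigma, so the part of Sigma within 3r of x projects onto a
    disc of radius r, and its area is at least an absolute constant times r^2
    ([two_sided_mass]).

    Loss of two-sidedness gives volume ([voluminous_tetrahedron]). If x is
    two-sided at scale r, two such crossing points x1, x2 span with x a triangle
    of area at least r^2 / 2. If all of Sigma within 6r of x were within r of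
    the plane of that triangle, the two caps that this slab cuts off from the
    ball would each avoid Sigma, hence lie on one side of U. Neither of the two
    balls fits into the slab and they are mirror images of each other, so the
    caps are on opposite sides, and x is two-sided at scale 2r along the normal
    of the plane. So at the scale where two-sidedness stops there is a fourth
    point x3 of Sigma with |det (x1 - x, x2 - x, x3 - x)| >= r^3.

    Moving the vertices of this tetrahedron by at most r / 512 keeps its
    curvature above a constant times 1 / r ([menger_curvature_ge]). If the
    four pieces of Sigma in which the vertices move have area at least m r^2,
    they contribute at least a constant times r^(-8) (m r^2)^4 = m^4 to the
    integral: the exponent 8 makes the contribution independent of the scale.

    The points of the dense set with cones are two-sided at all small scales,
    and no point is so at large scales because U is bounded; hence each has a
    largest k such that it fails to be two-sided at the dyadic scale M / 2^k. If
    this k has a maximum over the set, attained at x, then the cone points near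
    the four vertices are two-sided at all the smaller scales, so that m is an
    absolute constant ([fat_of_smallest_scale]). If k is unbounded, the lower
    area bound of the class gives an m that depends on Sigma
    ([fat_of_ahlfors]), but there are then such tetrahedra at infinitely many
    scales; their contributions add up, since the eighth powers of the curvature
    bounds grow geometrically as the scale shrinks ([integral_menger_ge]), so
    the integral exceeds every bound.

    Integrating over pieces of Sigma requires them to be measurable, which holds
    because the Hausdorff measure is additive on sets at positive distance
    ([closed_caratheodory]). *)

Set Implicit Arguments.
Unset Strict Implicit.
Unset Printing Implicit Defensive.
Import Order.TTheory GRing.Theory Num.Theory.
Import numFieldNormedType.Exports.

Local Open Scope classical_set_scope.
Local Open Scope ring_scope.

(** * Euclidean geometry of row vectors *)

Section euclid.
Context {R : realType}.
Implicit Types (u v w x y : 'rV[R]_3) (a b r : R).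

Let o0 : 'I_3 := @Ordinal 3 0 isT.
Let o1 : 'I_3 := @Ordinal 3 1 isT.
Let o2 : 'I_3 := @Ordinal 3 2 isT.

Lemma row3P u v : u ord0 o0 = v ord0 o0 -> u ord0 o1 = v ord0 o1 ->
  u ord0 o2 = v ord0 o2 -> u = v.
Proof.
move=> e0 e1 e2; apply/rowP => -[[|[|[|//]]] i].
- by rewrite (_ : Ordinal i = o0) //; apply: val_inj.
- by rewrite (_ : Ordinal i = o1) //; apply: val_inj.
- by rewrite (_ : Ordinal i = o2) //; apply: val_inj.
Qed.

Lemma dot3E u v : dot3 u v =
  u ord0 o0 * v ord0 o0 + u ord0 o1 * v ord0 o1 + u ord0 o2 * v ord0 o2.
Proof.
rewrite /dot3 !big_ord_recl big_ord0 addr0 addrA.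
by congr (_ * _ + _ * _ + _ * _); congr (_ ord0 _); apply: val_inj.
Qed.

Lemma cross3E u v :
  ((cross3 u v ord0 o0 = u ord0 o1 * v ord0 o2 - u ord0 o2 * v ord0 o1) *
   (cross3 u v ord0 o1 = u ord0 o2 * v ord0 o0 - u ord0 o0 * v ord0 o2) *
   (cross3 u v ord0 o2 = u ord0 o0 * v ord0 o1 - u ord0 o1 * v ord0 o0))%type.
Proof.
by rewrite !mxE; split; [split|]; congr (_ * _ - _ * _); congr (_ ord0 _);
  apply: val_inj.
Qed.

(* [cross3E] has to come before [mxE], which would unfold [cross3]. *)
Ltac coord := rewrite !(dot3E, cross3E, mxE).

Lemma dot3C u v : dot3 u v = dot3 v u.
Proof. by coord; ring. Qed.
Lemma dot3Dl u v w : dot3 (u + v) w = dot3 u w + dot3 v w.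
Proof. by coord; ring. Qed.
Lemma dot3Zl a u v : dot3 (a *: u) v = a * dot3 u v.
Proof. by coord; ring. Qed.
Lemma dot3Nl u v : dot3 (- u) v = - dot3 u v.
Proof. by coord; ring. Qed.
Lemma dot3Bl u v w : dot3 (u - v) w = dot3 u w - dot3 v w.
Proof. by rewrite dot3Dl dot3Nl. Qed.
Lemma dot3Dr u v w : dot3 u (v + w) = dot3 u v + dot3 u w.
Proof. by rewrite dot3C dot3Dl !(dot3C u). Qed.
Lemma dot3Zr a u v : dot3 u (a *: v) = a * dot3 u v.
Proof. by rewrite dot3C dot3Zl dot3C. Qed.
Lemma dot3Nr u v : dot3 u (- v) = - dot3 u v.
Proof. by rewrite dot3C dot3Nl dot3C. Qed.
Lemma dot30l u : dot3 0 u = 0.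
Proof. by coord; ring. Qed.
Lemma dot3_ge0 u : 0 <= dot3 u u.
Proof. by coord; rewrite !addr_ge0// -expr2 sqr_ge0. Qed.

Lemma dot3_eq0 u : dot3 u u = 0 -> u = 0.
Proof.
coord => h; have [h0 h1 h2] : [/\ u ord0 o0 = 0, u ord0 o1 = 0 & u ord0 o2 = 0].
  by split; apply/eqP; rewrite -sqrf_eq0; apply/eqP; nra.
by apply: row3P; rewrite mxE.
Qed.

Lemma enorm_ge0 u : 0 <= enorm u. Proof. exact: sqrtr_ge0. Qed.
Lemma enorm_sq u : enorm u ^+ 2 = dot3 u u.
Proof. by rewrite sqr_sqrtr// dot3_ge0. Qed.
Lemma enormN u : enorm (- u) = enorm u.
Proof. by rewrite /enorm dot3Nl dot3Nr opprK. Qed.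
Lemma enorm_sym u v : enorm (u - v) = enorm (v - u).
Proof. by rewrite -enormN opprB. Qed.
Lemma enormZ a u : enorm (a *: u) = `|a| * enorm u.
Proof.
by rewrite /enorm dot3Zl dot3Zr mulrA -expr2 sqrtrM ?sqr_ge0// sqrtr_sqr.
Qed.
Lemma enorm0 : enorm (0 : 'rV[R]_3) = 0.
Proof. by rewrite /enorm dot30l sqrtr0. Qed.
Lemma enorm0_eq0 u : enorm u = 0 -> u = 0.
Proof. by move=> h; apply: dot3_eq0; rewrite -enorm_sq h expr0n. Qed.

Lemma enorm_le_sq u r : 0 <= r -> dot3 u u <= r ^+ 2 -> enorm u <= r.
Proof. by move=> r0; rewrite -enorm_sq ler_pXn2r// nnegrE// enorm_ge0. Qed.

(** Lagrange's identity; both the Cauchy-Schwarz inequality and the bound on the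
    norm of the cross product follow by dropping one of the two squares. *)
Lemma lagrange_identity u v :
  dot3 (cross3 u v) (cross3 u v) + dot3 u v ^+ 2 = dot3 u u * dot3 v v.
Proof. by coord; ring. Qed.

Lemma enorm_cross u v : enorm (cross3 u v) <= enorm u * enorm v.
Proof.
apply: enorm_le_sq; first by rewrite mulr_ge0 ?enorm_ge0.
by rewrite exprMn !enorm_sq -lagrange_identity lerDl sqr_ge0.
Qed.

Lemma dot3_le u v : `|dot3 u v| <= enorm u * enorm v.
Proof.
rewrite -(@ler_pXn2r _ 2)// ?nnegrE ?mulr_ge0 ?enorm_ge0//.
by rewrite real_normK ?num_real// exprMn !enorm_sq -lagrange_identity lerDr dot3_ge0.
Qed.

Lemma enormD u v : enorm (u + v) <= enorm u + enorm v.
Proof.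
apply: enorm_le_sq; first by rewrite addr_ge0 ?enorm_ge0.
rewrite sqrrD !enorm_sq dot3Dl !dot3Dr (dot3C v u).
have := le_trans (ler_norm _) (dot3_le u v).
by rewrite mulr2n; lra.
Qed.

Lemma enorm_tri x y u : enorm (x - y) <= enorm (x - u) + enorm (u - y).
Proof. by rewrite -[x - y](subrKA u); exact: enormD. Qed.

Definition det3 u v w : R := dot3 w (cross3 u v).

Lemma det3_le u v w : `|det3 u v w| <= enorm u * enorm v * enorm w.
Proof.
apply: le_trans (dot3_le _ _) _; rewrite mulrC ler_wpM2r ?enorm_ge0//.
exact: enorm_cross.
Qed.

(** Multilinearity: the arguments are changed one at a time. *)
Lemma det3_perturb u v w u' v' w' : det3 u' v' w' - det3 u v w =
  det3 (u' - u) v' w' + det3 u (v' - v) w' + det3 u v (w' - w).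
Proof. by rewrite /det3; coord; ring. Qed.

(** A vector is recovered from its products with three independent vectors by
    Cramer's rule, with the cross products as the dual basis. *)
Lemma det3_coplanar n u v w :
  dot3 n u = 0 -> dot3 n v = 0 -> dot3 n w = 0 -> det3 u v w != 0 -> n = 0.
Proof.
move=> nu nv nw d0; apply: (scalerI d0); rewrite scaler0.
have -> : det3 u v w *: n = dot3 n w *: cross3 u v + dot3 n u *: cross3 v w +
    dot3 n v *: cross3 w u.
  by apply: row3P; rewrite /det3; coord; ring.
by rewrite nu nv nw !scale0r !addr0.
Qed.

Lemma orthonormal_frame v : enorm v = 1 -> exists e1 e2 : 'rV[R]_3,
  [/\ dot3 e1 e1 = 1, dot3 e2 e2 = 1, dot3 e1 e2 = 0, dot3 e1 v = 0
    & dot3 e2 v = 0].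
Proof.
move=> nv; have vv : dot3 v v = 1 by rewrite -enorm_sq nv expr1n.
suff [e1 [e11 e1v]] : exists e1, dot3 e1 e1 = 1 /\ dot3 e1 v = 0.
  exists e1, (cross3 v e1); split => //.
  - have := lagrange_identity v e1; rewrite vv e11 (dot3C v e1) e1v mulr1 => <-.
    by rewrite expr0n addr0.
  - by coord; ring.
  - by coord; ring.
(* Rotate the horizontal part of v by a right angle, unless v is vertical. *)
have [h|h] := eqVneq (v ord0 o0 ^+ 2 + v ord0 o1 ^+ 2) 0.
  have [h0 h1] : v ord0 o0 = 0 /\ v ord0 o1 = 0.
    by split; apply/eqP; rewrite -sqrf_eq0; apply/eqP; nra.
  exists (\row_i (if i == o0 then 1 else 0)).
  by split; coord => /=; rewrite ?h0; ring.
set s := Num.sqrt (v ord0 o0 ^+ 2 + v ord0 o1 ^+ 2).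
have ss : s ^+ 2 = v ord0 o0 ^+ 2 + v ord0 o1 ^+ 2.
  by rewrite sqr_sqrtr// addr_ge0// sqr_ge0.
have s0 : s != 0 by apply: contraNneq h => s0; rewrite -ss s0 expr0n.
exists (s^-1 *: \row_i (if i == o0 then - v ord0 o1
                        else if i == o1 then v ord0 o0 else 0)).
split; last by coord => /=; ring.
rewrite dot3Zl dot3Zr; coord => /=.
rewrite (_ : _ + 0 * 0 = s ^+ 2); first by field.
by rewrite ss; ring.
Qed.

Lemma frame_expand e1 e2 v : dot3 e1 e1 = 1 -> dot3 e2 e2 = 1 ->
  dot3 v v = 1 -> dot3 e1 e2 = 0 -> dot3 e1 v = 0 -> dot3 e2 v = 0 ->
  forall a b c, dot3 (a *: e1 + b *: e2 + c *: v) (a *: e1 + b *: e2 + c *: v)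
    = a ^+ 2 + b ^+ 2 + c ^+ 2.
Proof.
move=> h1 h2 h3 h4 h5 h6 a b c.
rewrite !(dot3Dl, dot3Dr, dot3Zl, dot3Zr) (dot3C e2 e1) (dot3C v e1) (dot3C v e2).
by rewrite h1 h2 h3 h4 h5 h6; ring.
Qed.


Lemma norm_le_enorm u : `|u| <= enorm u.
Proof.
rewrite (_ : `|u| = mx_norm u)// mx_normrE.
apply: bigmax_le => [|[i j] _ /=]; first exact: enorm_ge0.
rewrite -(@ler_pXn2r _ 2)// ?nnegrE ?enorm_ge0// enorm_sq real_normK ?num_real//.
rewrite (ord1 i) /dot3 (bigD1 j)//= -expr2 lerDl sumr_ge0// => k _.
by rewrite -expr2 sqr_ge0.
Qed.

Lemma enorm_le_norm u : enorm u <= 2 * `|u|.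
Proof.
have h k : u ord0 k ^+ 2 <= `|u| ^+ 2.
  rewrite -[leLHS]real_normK ?num_real// ler_pXn2r ?nnegrE//.
  rewrite (_ : `|u| = mx_norm u)// mx_normrE.
  exact: (le_bigmax _ (fun i => `|u i.1 i.2|) (ord0, k)).
apply: enorm_le_sq; first by rewrite mulr_ge0.
have := sqr_ge0 `|u|; have := h o0; have := h o1; have := h o2.
by rewrite dot3E -!expr2 exprMn; lra.
Qed.

Lemma nbhs_eball x (A : set 'rV[R]_3) :
  nbhs x A -> exists2 e, 0 < e & eball x e `<=` A.
Proof.
move=> /nbhs_ballP[e /= e0 eA]; exists (e / 2); first by rewrite divr_gt0.
move=> y; rewrite /eball /= => h; apply: eA; rewrite -ball_normE /=.
rewrite -normrN opprB (le_lt_trans (norm_le_enorm _))// (le_lt_trans h)//.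
by rewrite ltr_pdivrMr// ltr_pMr// ltr1n.
Qed.

Lemma eball_nbhs x e : 0 < e -> nbhs x (eball x e).
Proof.
move=> e0; apply/nbhs_ballP; exists (e / 2) => /=; first by rewrite divr_gt0.
move=> y; rewrite -ball_normE /= => h; rewrite /eball /=.
rewrite (le_trans (enorm_le_norm _))// -normrN opprB; lra.
Qed.

Lemma closure_eball x e (A : set 'rV[R]_3) : 0 < e -> closure A x ->
  exists2 y, A y & enorm (y - x) <= e.
Proof. by move=> e0 /(_ _ (eball_nbhs x e0)) [y [Ay hy]]; exists y. Qed.

(** The parameters in U form a nonempty open subset of [0, 1]; if the segment
    avoided the boundary they would also form a closed subset, hence everything
    because [0, 1] is connected. *)
Lemma segment_boundary (U : set 'rV[R]_3) y z : open U -> U y -> ~ U z ->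
  exists2 t, 0 <= t <= 1 & boundary U (y + t *: (z - y)).
Proof.
move=> oU Uy nUz; apply: contrapT => h.
pose g t := y + t *: (z - y).
have cg : continuous g.
  move=> t; apply: cvgD; first exact: cvg_cst.
  by apply: cvgZr_tmp => //; exact: cvg_id.
have := @segment_connected R 0 1.
move=> /(_ [set t | t \in `[0, 1] /\ U (g t)]) H.
suff : [set t | t \in `[0, 1] /\ U (g t)] = `[0, 1]%classic.
  move=> /seteqP[_ /(_ 1)]; rewrite /= in_itv /= ler01 lexx => -[//|_].
  by rewrite /g scale1r addrCA subrr addr0.
apply: H.
- by exists 0; rewrite /= in_itv /= ler01 lexx; split => //; rewrite /g scale0r addr0.
- by exists (g @^-1` U); [exact: open_comp|apply/seteqP; split => t /=].
- exists (g @^-1` closure U).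
    by apply: closed_comp => [? _|]; [exact: cg|exact: closed_closure].
  apply/seteqP; split => t /= [t01 Ut]; split => //; first exact: subset_closure.
  apply: contrapT => nU; apply: h; exists t; first by rewrite in_itv in t01.
  by split => // /interior_subset.
Qed.

End euclid.

(** * The Hausdorff measure is a metric outer measure *)

Section hausdorff.
Context {R : realType}.
Implicit Types (A B X F : set 'rV[R]_3) (x y : 'rV[R]_3).
Local Open Scope ereal_scope.

Lemma diam_ub A x y : A x -> A y -> (enorm (x - y))%:E <= diam A.
Proof. by move=> Ax Ay; apply: ereal_sup_ubound; right; exists (x, y). Qed.

Lemma diam_le A (r : R) : (0 <= r)%R ->
  (forall x y, A x -> A y -> (enorm (x - y) <= r)%R) -> diam A <= r%:E.
Proof.
move=> r0 h; apply: ge_ereal_sup => _ [->|[[x y] [/= Ax Ay] <-]].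
  by rewrite lee_fin.
by rewrite lee_fin h.
Qed.

Lemma le_diam A B : A `<=` B -> diam A <= diam B.
Proof.
move=> AB; apply: ge_ereal_sup => _ [->|[[x y] [/= Ax Ay] <-]].
  exact: diam_ge0.
by apply: diam_ub; exact: AB.
Qed.

Let zeta_ge0 A : 0 <= (pi / 4)%:E * diam A ^+ 2.
Proof.
apply: mule_ge0; last exact/expe_ge0/diam_ge0.
by rewrite lee_fin divr_ge0// pi_ge0.
Qed.

Let le_zeta A B : A `<=` B ->
  (pi / 4)%:E * diam A ^+ 2 <= (pi / 4)%:E * diam B ^+ 2.
Proof.
move=> AB; apply: lee_wpmul2l; first by rewrite lee_fin divr_ge0// pi_ge0.
by rewrite !expe2; apply: lee_pmul; rewrite ?diam_ge0// le_diam.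
Qed.

Let zeta0 : (pi / 4)%:E * diam (@set0 'rV[R]_3) ^+ 2 = 0.
Proof. by rewrite diam0 expe2 mule0 mule0. Qed.

Definition separated_by (e : R) A B :=
  forall x y, A x -> B y -> (e <= enorm (x - y))%R.

(** No set of diameter less than e meets both A and B, so a cover of the union
    by such sets splits into a cover of A and a cover of B. *)
Lemma hausdorff2_delta_sep A B (d e : R) : (0 < d)%R -> (d < e)%R ->
  separated_by e A B ->
  hausdorff2_delta d A + hausdorff2_delta d B <= hausdorff2_delta d (A `|` B).
Proof.
move=> d0 de sep; apply: le_ereal_inf_tmp => _ [F [dF cF] <-].
have H C : C `<=` A `|` B -> hausdorff2_delta d C <=
    \sum_(k <oo) (pi / 4)%:E * diam (F k `&` C) ^+ 2.
  move=> CAB; apply: ereal_inf_lbound; exists (fun k => F k `&` C) => //; split.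
    by move=> k; apply: le_trans (dF k); apply: le_diam; exact: subIsetl.
  by move=> x Cx; have [k _ Fk] := cF _ (CAB _ Cx); exists k.
apply: le_trans (leeD (H A _) (H B _)) _; [exact: subsetUl|exact: subsetUr|].
rewrite -nneseriesD//; apply: lee_nneseries => [k _ _|k _].
  exact: adde_ge0.
have [->|/set0P[x [Fx Ax]]] := eqVneq (F k `&` A) set0.
  by rewrite zeta0 add0e; apply: le_zeta; exact: subIsetl.
suff -> : F k `&` B = set0.
  by rewrite zeta0 adde0; apply: le_zeta; exact: subIsetl.
apply/seteqP; split => // y [Fy By].
have := le_trans (diam_ub Fx Fy) (dF k).
rewrite lee_fin leNgt (lt_le_trans de)//; exact: sep.
Qed.

Lemma le_hausdorff2_delta_mesh A (d e : R) : (d <= e)%R ->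
  hausdorff2_delta e A <= hausdorff2_delta d A.
Proof.
move=> de; apply/ereal_inf_le_tmp => _ [F [dF cF] <-]; exists F => //; split => //.
by move=> k; apply: le_trans (dF k) _; rewrite lee_fin.
Qed.

Lemma ereal_supD_le (S T : set (\bar R)) c : S !=set0 -> T !=set0 ->
  (forall a, S a -> 0 <= a) -> (forall b, T b -> 0 <= b) ->
  (forall a b, S a -> T b -> a + b <= c) -> ereal_sup S + ereal_sup T <= c.
Proof.
move=> [s0 Ss0] [t0 Tt0] S0 T0 h.
have [->|cy] := eqVneq c +oo; first by rewrite leey.
have bfin a : 0 <= a -> a <= c -> a \is a fin_num.
  by move=> a0 ac; rewrite ge0_fin_numE// (le_lt_trans ac)// ltey.
have Sfin a : S a -> a \is a fin_num.
  move=> Sa; apply: bfin; first exact: S0.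
  by apply: le_trans (h _ _ Sa Tt0); rewrite leeDl// T0.
have hT a : S a -> a + ereal_sup T <= c.
  move=> Sa; rewrite -leeBrDl ?Sfin//; apply: ge_ereal_sup => b Tb.
  by rewrite leeBrDl ?Sfin// h.
have Tge0 : 0 <= ereal_sup T by apply: le_trans (T0 _ Tt0) (ereal_sup_ubound _).
have Tfin : ereal_sup T \is a fin_num.
  apply: bfin => //; apply: le_trans (hT _ Ss0); rewrite leeDr//; exact: S0.
rewrite -leeBrDr//; apply: ge_ereal_sup => a Sa.
by rewrite leeBrDr// hT.
Qed.

Lemma hausdorff2_sep A B (e : R) : (0 < e)%R -> separated_by e A B ->
  hausdorff2 A + hausdorff2 B <= hausdorff2 (A `|` B).
Proof.
move=> e0 sep; apply: ereal_supD_le.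
- by exists (hausdorff2_delta 1 A); exists 1%R => //=.
- by exists (hausdorff2_delta 1 B); exists 1%R => //=.
- by move=> _ [d d0 <-]; exact: hausdorff2_delta_ge0.
- by move=> _ [d d0 <-]; exact: hausdorff2_delta_ge0.
move=> _ _ [d1 /= d10 <-] [d2 /= d20 <-].
pose d := Num.min (Num.min d1 d2) (e / 2)%R.
have d0 : (0 < d)%R by rewrite !lt_min d10 d20 divr_gt0.
have de : (d < e)%R.
  by rewrite gt_min ltr_pdivrMr// ltr_pMr// ltr1n orbT.
apply: le_trans (leeD (@le_hausdorff2_delta_mesh A d d1 _)
                      (@le_hausdorff2_delta_mesh B d d2 _)) _.
- by rewrite !ge_min lexx.
- by rewrite !ge_min lexx orbT.
apply: le_trans (hausdorff2_delta_sep d0 de sep) _.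
by apply: ereal_sup_ubound; exists d.
Qed.

Lemma hausdorff2_sum_sep (B : nat -> set 'rV[R]_3) X n :
  (forall k, B k `<=` X) ->
  (forall k, exists2 e : R, (0 < e)%R &
     forall j, (j < k)%N -> separated_by e (B j) (B k)) ->
  \sum_(k < n) hausdorff2 (B k) <= hausdorff2 X.
Proof.
move=> BX sep.
apply: le_trans (_ : hausdorff2 (\bigcup_(j in `I_n) B j) <= _); last first.
  by apply: le_hausdorff2; exact: bigcup_sub.
elim: n => [|n IH]; first by rewrite big_ord0 hausdorff2_ge0.
rewrite big_ord_recr /= bigcup_mkord big_ord_recr /= -bigcup_mkord.
have [e e0 he] := sep n.
apply: le_trans (leeD IH (lexx _)) (hausdorff2_sep e0 _).
by move=> x y [j /= jn Bx] By; exact: (he j).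
Qed.

Lemma sum_double (f : nat -> \bar R) n : \sum_(i < n.*2) f i =
  \sum_(i < n) f i.*2 + \sum_(i < n) f i.*2.+1.
Proof.
elim: n => [|n IH]; first by rewrite !big_ord0 adde0.
by rewrite doubleS !big_ord_recr /= IH !addeA; congr (_ + _); rewrite addeAC.
Qed.

(** Caratheodory's criterion. Slice the part of X outside F into the shells
    [Rg n] of points at distance between 1 / (n+2) and 1 / (n+1) from F. Shells
    of the same parity are separated from each other, so the series of their
    measures converges, and the part A N of X at distance at least 1 / (N+1)
    from F carries all the measure of X outside F but a small tail. Since A N is
    separated from F, additivity on separated sets concludes. *)
Lemma closed_caratheodory F : closed F ->
  caratheodory_measurable (hausdorff2_outer R) F.
Proof.
move=> cF; apply: le_caratheodory_measurable => X.
rewrite /hausdorff2_outer /=.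
have [->|Xoo] := eqVneq (hausdorff2 X) +oo; first by rewrite leey.
pose A n := [set x | X x /\ forall z, F z -> (n.+1%:R^-1 <= enorm (x - z))%R].
have AX n : A n `<=` X by move=> x [].
have Amono m n : (m <= n)%N -> A m `<=` A n.
  move=> mn x [Xx h]; split => // z Fz; apply: le_trans (h _ Fz).
  by rewrite lef_pV2 ?posrE// ler_nat.
pose Rg n := A n.+1 `\` A n.
have RX n : Rg n `<=` X by move=> x [[]].
pose gap m : R := (m.+1%:R^-1 - m.+2%:R^-1)%R.
have gap0 m : (0 < gap m)%R.
  by rewrite subr_gt0 ltf_pV2 ?posrE// ltr_nat.
have sepA m B : (forall y, B y -> X y /\ ~ A m.+1 y) ->
    separated_by (gap m) (A m) B.
  move=> hB x y [Xx hx] /hB [Xy nAy].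
  have [z Fz hz] : exists2 z, F z & (enorm (y - z) < m.+2%:R^-1)%R.
    apply: contrapT => h; apply: nAy; split => // z Fz.
    by rewrite leNgt; apply/negP => hz; apply: h; exists z.
  rewrite /gap lerBlDr (le_trans (hx _ Fz))// (le_trans (enorm_tri x z y))//.
  by rewrite lerD2l ltW.
have sumR n : \sum_(k < n.*2) hausdorff2 (Rg k) <= hausdorff2 X + hausdorff2 X.
  rewrite (sum_double (fun k => hausdorff2 (Rg k))); apply: leeD;
    [apply: (@hausdorff2_sum_sep (fun k => Rg k.*2))
    |apply: (@hausdorff2_sum_sep (fun k => Rg k.*2.+1))] => //.
  - case=> [|k]; first by exists 1%R.
    exists (gap k.*2.+1) => // j jk x y Rx [Ay1 Ay0].
    apply: (@sepA _ (Rg k.+1.*2)) => //; first by move=> z [[? ?] ?].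
    by apply: Amono Rx.1; rewrite ltnS leq_double -ltnS.
  - move=> k; exists (gap k.*2) => // j jk x y Rx [Ay1 Ay0].
    apply: (@sepA _ (Rg k.*2.+1)) => //; first by move=> z [[? ?] ?].
    by apply: Amono Rx.1; rewrite -doubleS leq_double.
have Rfin : \sum_(0 <= k <oo) hausdorff2 (Rg k) < +oo.
  apply: (@le_lt_trans _ _ (hausdorff2 X + hausdorff2 X)); last first.
    by rewrite lte_add_pinfty// ltey.
  apply: lime_le.
    by apply: is_cvg_nneseries => k _ _; exact: hausdorff2_ge0.
  apply: nearW => n; apply: le_trans (sumR n).
  rewrite -(big_mkord xpredT (fun k => hausdorff2 (Rg k))).
  apply: lee_sum_nneg_natr => [k _ _|]; first exact: hausdorff2_ge0.
  by rewrite -addnn leq_addr.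
have tail0 := nneseries_tail_cvg Rfin (fun k _ => hausdorff2_ge0 (Rg k)).
have key N : hausdorff2 (X `&` F) + hausdorff2 (X `&` ~` F) <=
    hausdorff2 X + \sum_(N <= k <oo) hausdorff2 (Rg k).
  apply: le_trans (_ : _ <= hausdorff2 (X `&` F) + (hausdorff2 (A N) +
      \sum_(N <= k <oo) hausdorff2 (Rg k))) _.
    apply: leeD => //.
    apply: le_trans (leeD (lexx (hausdorff2 (A N)))
      (outer_measure_sigma_subadditive_tail (hausdorff2_outer R) N Rg)).
    apply: le_trans (outer_measureU2 (hausdorff2_outer R) _ _).
    apply: le_hausdorff2 => x [Xx nFx].
    have [n hn] : exists n, A n x.
      have /nbhs_eball[e e0 he] : nbhs x (~` F).
        by apply: open_nbhs_nbhs; split => //; exact: closed_openC.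
      have [n hn] : exists n, (n.+1%:R^-1 < e)%R.
        by near \oo => n; exists n; near: n; exact: near_infty_natSinv_lt (PosNum e0).
      exists n; split => // z Fz; rewrite leNgt; apply/negP => hz.
      by apply: (he z) => //; rewrite /eball /= enorm_sym ltW// (lt_trans hz).
    have [ANx|nANx] := pselect (A N x); [by left|right].
    have : exists m, `[< A m x >] by exists n; apply/asboolP.
    move=> /ex_minnP[[|m] /asboolP Am mmin].
      by exfalso; apply: nANx; exact: Amono Am.
    exists m => /=.
      by move=> mN; apply: nANx; exact: Amono Am.
    split => // Am'; have /mmin : `[< A m x >] by apply/asboolP.
    by rewrite ltnn.
  rewrite addeA; apply: leeD => //.
  have e0 : (0 < N.+1%:R^-1 :> R)%R by rewrite invr_gt0.
  rewrite addeC; apply: le_trans (hausdorff2_sep e0 _) _.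
    by move=> x y [_ hx] [_ Fy]; exact: hx.
  by apply: le_hausdorff2 => x [[]|[]].
apply/lee_addgt0Pr => e e0.
have [N hN] : exists N, \sum_(N <= k <oo) hausdorff2 (Rg k) <= e%:E.
  move/fine_cvgP : tail0 => [tf] /cvgrPdist_le /(_ _ e0) te.
  near \oo => N; exists N.
  rewrite -[leLHS]fineK; last by near: N.
  rewrite lee_fin (le_trans (ler_norm _))//.
  rewrite -normrN -sub0r; near: N; exact: te.
by apply: le_trans (key N) _; exact: leeD.
Unshelve. all: by end_near. Qed.

End hausdorff.

(** * A set with a large projection has large area *)

Section projection.
Context {R : realType}.
Implicit Types (A : set 'rV[R]_3) (x y e : 'rV[R]_3).

Let RR := (measurableTypeR R * measurableTypeR R)%type.

Let lam2 : {measure set RR -> \bar R} :=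
  (@lebesgue_measure R \x @lebesgue_measure R)%E.

Let lam2_square (a b s : R) : 0 <= s ->
  lam2 (`[a, a + s] `*` `[b, b + s]) = (s ^+ 2)%:E.
Proof.
move=> s0; rewrite [LHS]product_measure1E//= !lebesgue_measure_itv /= !lte_fin.
rewrite !ltrDl; case: ltP => [_|s_le0].
  by rewrite -!EFinD -EFinM; congr (_%:E); ring.
by rewrite mule0 (_ : s = 0) ?expr0n//; apply/eqP; rewrite eq_le s0 s_le0.
Qed.

Lemma dot3_unit_le e u v : dot3 e e = 1 ->
  `|dot3 u e - dot3 v e| <= enorm (u - v).
Proof.
move=> e1; rewrite -dot3Bl (le_trans (dot3_le _ _))//.
by rewrite (_ : enorm e = 1) ?mulr1// /enorm e1 sqrtr1.
Qed.

(** A set of diameter d projects into a square of side 2d, so a cover of A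
    yields a cover of the square of side s by squares of total area at most
    4 d^2 <= 8 (pi / 4) d^2 summed over the cover. *)
Lemma hausdorff2_projection e1 e2 A x (s : R) : 0 <= s ->
  dot3 e1 e1 = 1 -> dot3 e2 e2 = 1 ->
  (forall a b, 0 <= a <= s -> 0 <= b <= s ->
    exists y, [/\ A y, dot3 (y - x) e1 = a & dot3 (y - x) e2 = b]) ->
  ((s ^+ 2 / 8)%:E <= hausdorff2 A)%E.
Proof.
move=> s0 e11 e22 proj.
apply: (@le_trans _ _ (hausdorff2_delta 1 A)); last first.
  by apply: ereal_sup_ubound; exists 1 => //=.
apply: le_ereal_inf_tmp => _ [F [dF cF] <-].
pose d k := fine (diam (F k)).
have dE k : diam (F k) = (d k)%:E.
  rewrite /d fineK// ge0_fin_numE ?diam_ge0//.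
  by apply: le_lt_trans (dF k) _; rewrite ltry.
have d0 k : 0 <= d k by rewrite fine_ge0// diam_ge0.
have [p hp] : {p : nat -> 'rV[R]_3 & forall k, F k !=set0 -> F k (p k)}.
  apply: (@choice _ _ (fun k y => F k !=set0 -> F k y)) => k.
  by have [[y Fy]|h] := pselect (F k !=set0); [exists y|exists 0].
pose Q k : set RR :=
  `[dot3 (p k - x) e1 - d k, dot3 (p k - x) e1 - d k + (d k *+ 2)] `*`
  `[dot3 (p k - x) e2 - d k, dot3 (p k - x) e2 - d k + (d k *+ 2)].
have mQ k : measurable (Q k) by apply: measurableX.
have cov : `[0, 0 + s] `*` `[0, 0 + s] `<=` \bigcup_k Q k.
  move=> [a b] [/=]; rewrite !in_itv /= add0r => ha hb.
  have [y [Ay ya yb]] := proj _ _ ha hb.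
  have [k _ Fy] := cF _ Ay; exists k => //.
  have Fp : F k (p k) by apply: hp; exists y.
  have yp : enorm ((y - x) - (p k - x)) <= d k.
    by rewrite opprB addrA subrK -lee_fin -dE; exact: diam_ub.
  have := le_trans (dot3_unit_le _ _ e11) yp.
  have := le_trans (dot3_unit_le _ _ e22) yp.
  rewrite ya yb !ler_norml /Q /= !in_itv /= !mulr2n => /andP[h1 h2] /andP[h3 h4].
  by split; apply/andP; split; lra.
have := @measure_sigma_subadditive _ _ _ lam2 _ _ mQ (measurableX _ _) cov.
rewrite lam2_square// => /(_ (measurable_itv _) (measurable_itv _)) le_s.
have : ((s ^+ 2)%:E <= 8%:E * \sum_(k <oo) ((pi / 4)%:E * diam (F k) ^+ 2))%E.
  apply: le_trans le_s _; rewrite -nneseriesZl; last first.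
    move=> k _; rewrite dE -EFin_expe -EFinM lee_fin.
    by rewrite mulr_ge0 ?sqr_ge0 ?divr_ge0 ?pi_ge0.
  apply: lee_nneseries => // k _; rewrite lam2_square ?mulrn_wge0//.
  rewrite dE -EFin_expe -!EFinM lee_fin.
  by have := pi_ge2 R; have := sqr_ge0 (d k); nra.
by move=> le8; rewrite EFinM lee_pdivrMr// muleC.
Qed.

End projection.

(** * Points that see both sides of the surface *)

Ltac vring := by apply/rowP => ?; rewrite !mxE; ring.

Section two_sided.
Context {R : realType}.
Implicit Types (U : set 'rV[R]_3) (x y v n : 'rV[R]_3) (r : R).

Definition two_sided U x r := exists v, [/\ enorm v = 1,
  eball (x + (2 * r) *: v) r `<=` U & eball (x - (2 * r) *: v) r `<=` ~` U].

(** The ends of the segment of length 4r parallel to v and centred at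
    x + a e1 + b e2 lie in the two balls. *)
Lemma two_sided_line U x r v e1 e2 : open U ->
  eball (x + (2 * r) *: v) r `<=` U -> eball (x - (2 * r) *: v) r `<=` ~` U ->
  0 <= r -> enorm v = 1 -> dot3 e1 e1 = 1 -> dot3 e2 e2 = 1 ->
  dot3 e1 e2 = 0 -> dot3 e1 v = 0 -> dot3 e2 v = 0 ->
  forall a b : R, a ^+ 2 + b ^+ 2 <= r ^+ 2 -> exists2 t : R, `|t| <= 2 * r &
    boundary U (x + (a *: e1 + b *: e2 + t *: v)).
Proof.
move=> oU Uv nUv r0 nv e11 e22 e12 e1v e2v a b ab.
have vv : dot3 v v = 1 by rewrite -enorm_sq nv expr1n.
have hab : enorm (a *: e1 + b *: e2) <= r.
  apply: enorm_le_sq => //.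
  have := frame_expand e11 e22 vv e12 e1v e2v a b 0.
  by rewrite scale0r addr0 => ->; rewrite expr0n addr0.
set q := a *: e1 + b *: e2 in hab *.
have Uy : U (x + (q + (2 * r) *: v)).
  by apply: Uv; rewrite /eball /= (_ : _ - _ = q)//; vring.
have nUz : ~ U (x + (q - (2 * r) *: v)).
  by apply: nUv; rewrite /eball /= (_ : _ - _ = q)//; vring.
have [t /andP[t0 t1] bt] := segment_boundary oU Uy nUz.
exists (2 * r - 4 * r * t); first by rewrite ler_norml; apply/andP; split; nra.
by move: bt; congr (boundary U _); vring.
Qed.

(** The square of side r / 2 spanned by e1 and e2 at x is contained in the disc
    of radius r on which [two_sided_line] finds points of the boundary. *)
Lemma two_sided_mass U x r : open U -> 0 < r -> two_sided U x r ->
  ((r ^+ 2 / 32)%:E <= hausdorff2 (boundary U `&` eball x (3 * r)))%E.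
Proof.
move=> oU r0 [v [nv Uv nUv]].
have vv : dot3 v v = 1 by rewrite -enorm_sq nv expr1n.
have [e1 [e2 [e11 e22 e12 e1v e2v]]] := orthonormal_frame nv.
have := @hausdorff2_projection R e1 e2 (boundary U `&` eball x (3 * r)) x (r / 2).
rewrite (_ : (r / 2) ^+ 2 / 8 = r ^+ 2 / 32); last by field.
apply => //; first by rewrite divr_ge0// ltW.
move=> a b /andP[a0 ar] /andP[b0 br].
have ab : a ^+ 2 + b ^+ 2 <= r ^+ 2 by nra.
have [t ht bt] := two_sided_line oU Uv nUv (ltW r0) nv e11 e22 e12 e1v e2v ab.
eexists; split; first split; first exact: bt.
- rewrite /eball /= addrAC subrr add0r.
  apply: enorm_le_sq; first by rewrite mulr_ge0// ltW.
  rewrite frame_expand//.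
  have : t ^+ 2 <= (2 * r) ^+ 2.
    by rewrite -(real_normK (num_real t)) ler_pXn2r// nnegrE// mulr_ge0// ltW.
  nra.
- rewrite addrAC subrr add0r !dot3Dl !dot3Zl e11 (dot3C e2) e12 (dot3C v) e1v.
  by ring.
- by rewrite addrAC subrr add0r !dot3Dl !dot3Zl e22 e12 (dot3C v) e2v; ring.
Qed.

(** A cap of a ball is convex, so a segment in it would have to cross the
    boundary to leave U. *)
Lemma cap_one_side U x n (rho h : R) : open U ->
  (forall q, boundary U q -> enorm (q - x) <= rho -> dot3 (q - x) n < h) ->
  forall y z, enorm (y - x) <= rho -> enorm (z - x) <= rho ->
  h <= dot3 (y - x) n -> h <= dot3 (z - x) n -> U y -> U z.
Proof.
move=> oU slab y z yr zr hy hz Uy; apply: contrapT => nUz.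
have [t /andP[t0 t1] bt] := segment_boundary oU Uy nUz.
have qE : y + t *: (z - y) - x = (1 - t) *: (y - x) + t *: (z - x).
  by vring.
have hq : enorm ((1 - t) *: (y - x) + t *: (z - x)) <= rho.
  by rewrite (le_trans (enormD _ _))// !enormZ !ger0_norm ?subr_ge0//; nra.
by have := slab _ bt; rewrite qE => /(_ hq); rewrite dot3Dl !dot3Zl; nra.
Qed.

(** If every such determinant were small, the boundary near x would lie in a slab
    around the plane through x, x1 and x2, and the caps on its two sides would
    make x two-sided at scale 2r. *)
Lemma voluminous_tetrahedron U x r : open U -> 0 < r ->
  two_sided U x r -> ~ two_sided U x (2 * r) ->
  exists x1 x2 x3, [/\ boundary U x1, boundary U x2, boundary U x3,
    [/\ enorm (x1 - x) <= 6 * r, enorm (x2 - x) <= 6 * r &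
        enorm (x3 - x) <= 6 * r] &
    r ^+ 3 <= `|det3 (x1 - x) (x2 - x) (x3 - x)|].
Proof.
move=> oU r0 [v [nv Uv nUv]] n2; have rge0 := ltW r0.
have vv : dot3 v v = 1 by rewrite -enorm_sq nv expr1n.
have [e1 [e2 [e11 e22 e12 e1v e2v]]] := orthonormal_frame nv.
have line := two_sided_line oU Uv nUv rge0 nv e11 e22 e12 e1v e2v.
have [t1 ht1] : exists2 t : R, `|t| <= 2 * r &
    boundary U (x + (r *: e1 + 0 *: e2 + t *: v)).
  by apply: line; rewrite expr0n addr0.
have [t2 ht2] : exists2 t : R, `|t| <= 2 * r &
    boundary U (x + (0 *: e1 + r *: e2 + t *: v)).
  by apply: line; rewrite expr0n add0r.
set u1 := r *: e1 + _ + _; set u2 := 0 *: e1 + _ + _ => b2 b1.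
have sq (t : R) : `|t| <= 2 * r -> t ^+ 2 <= (2 * r) ^+ 2.
  by move=> ht; rewrite -(real_normK (num_real t)) ler_pXn2r// nnegrE// mulr_ge0.
have u11 : dot3 u1 u1 = r ^+ 2 + t1 ^+ 2 by rewrite frame_expand//; ring.
have u22 : dot3 u2 u2 = r ^+ 2 + t2 ^+ 2 by rewrite frame_expand//; ring.
have u12 : dot3 u1 u2 = t1 * t2.
  rewrite /u1 /u2 !(dot3Dl, dot3Dr, dot3Zl, dot3Zr) (dot3C e2 e1) (dot3C v e1).
  by rewrite (dot3C v e2) e11 e22 e12 e1v e2v vv; ring.
set w := cross3 u1 u2.
have w_ge : r ^+ 2 <= enorm w.
  rewrite -(@ler_pXn2r _ 2)// ?nnegrE ?enorm_ge0 ?exprn_ge0// enorm_sq.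
  have := lagrange_identity u1 u2; rewrite u11 u22 u12 -/w.
  have := sqr_ge0 t1; have := sqr_ge0 t2; have := sqr_ge0 r; nra.
have r2 : 0 < r ^+ 2 by rewrite exprn_gt0.
have w0 : 0 < enorm w by apply: lt_le_trans w_ge.
have n1 : enorm u1 <= 6 * r.
  apply: enorm_le_sq; first by rewrite mulr_ge0.
  by rewrite u11; have := sq _ ht1; nra.
have n2' : enorm u2 <= 6 * r.
  apply: enorm_le_sq; first by rewrite mulr_ge0.
  by rewrite u22; have := sq _ ht2; nra.
apply: contrapT => noT.
have xK u : x + u - x = u by vring.
(* Otherwise the boundary near x is close to the plane orthogonal to w. *)
have slabw q : boundary U q -> enorm (q - x) <= 6 * r -> `|dot3 (q - x) w| < r ^+ 3.
  move=> bq hq; rewrite ltNge; apply/negP => big; apply: noT.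
  exists (x + u1), (x + u2), q; rewrite !xK.
  by split.
(* The unit normal is oriented like v, so that x + 2rv + rn, a point of the ball
   inside U, is on the positive side of the slab. *)
pose s : R := if 0 <= dot3 w v then 1 else -1.
pose n := (s / enorm w) *: w.
have s1 : `|s| = 1 by rewrite /s; case: ifP => _; rewrite ?normrN normr1.
have nn : enorm n = 1.
  by rewrite enormZ normrM s1 normfV (ger0_norm (ltW w0)) mul1r mulVf// gt_eqF.
have nv0 : 0 <= dot3 n v.
  rewrite dot3Zl mulrAC -/(dot3 w v) divr_ge0 ?enorm_ge0// /s.
  by case: ifPn => [wv|]; rewrite ?mul1r// -ltNge mulN1r oppr_ge0 => /ltW.
have slab p : boundary U p -> enorm (p - x) <= 6 * r -> `|dot3 (p - x) n| < r.
  move=> bq hq; rewrite dot3Zr normrM normrM s1 mul1r normfV (ger0_norm (ltW w0)).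
  rewrite mulrC ltr_pdivrMr//; apply: lt_le_trans (slabw _ bq hq) _.
  by rewrite exprS ler_wpM2l.
clearbody n.
have capP := @cap_one_side U x n (6 * r) r oU.
have capN := @cap_one_side U x (- n) (6 * r) r oU.
have dnn : dot3 n n = 1 by rewrite -enorm_sq nn expr1n.
have dnle u : enorm u <= 2 * r -> `|dot3 u n| <= 2 * r.
  by move=> hu; rewrite (le_trans (dot3_le _ _))// nn mulr1.
have Dr u : enorm u <= 2 * r -> enorm ((2 * (2 * r)) *: n + u) <= 6 * r.
  move=> hu; rewrite (le_trans (enormD _ _))// enormZ nn ger0_norm ?mulr_ge0//; lra.
have h0 : enorm ((2 * r) *: v + r *: n) <= 6 * r.
  by rewrite (le_trans (enormD _ _))// !enormZ nn nv !ger0_norm ?mulr_ge0//; lra.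
apply: n2; exists n; split => //.
- move=> y; rewrite /eball /= => hy.
  set u := y - (x + (2 * (2 * r)) *: n) in hy.
  have yE : y - x = (2 * (2 * r)) *: n + u.
    by rewrite /u; vring.
  have {}capP := capP (fun q bq hq => le_lt_trans (ler_norm _) (slab q bq hq)).
  apply: (capP (x + ((2 * r) *: v + r *: n))).
  + by rewrite addrAC subrr add0r.
  + by rewrite yE Dr.
  + rewrite addrAC subrr add0r dot3Dl !dot3Zl dnn (dot3C v); nra.
  + rewrite yE dot3Dl dot3Zl dnn.
    by have := dnle _ hy; rewrite ler_norml => /andP[]; lra.
  + apply: Uv; rewrite /eball /= (_ : _ - _ = r *: n); last by vring.
    by rewrite enormZ nn ger0_norm// mulr1.
- move=> y; rewrite /eball /= => hy Uy.
  set u := y - (x - (2 * (2 * r)) *: n) in hy.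
  have yE : y - x = - ((2 * (2 * r)) *: n + - u).
    by rewrite /u; vring.
  have hy' : enorm (- u) <= 2 * r by rewrite enormN.
  have {}capN : forall y z : 'rV[R]_3,
      enorm (y - x) <= 6 * r -> enorm (z - x) <= 6 * r ->
      r <= dot3 (y - x) (- n) -> r <= dot3 (z - x) (- n) -> U y -> U z.
    apply: capN => q bq hq; rewrite dot3Nr; apply: le_lt_trans (slab q bq hq).
    by rewrite -normrN ler_norm.
  apply: (nUv (x - ((2 * r) *: v + r *: n))).
    rewrite /eball /= (_ : _ - _ = - (r *: n)); last by vring.
    by rewrite enormN enormZ nn ger0_norm// mulr1.
  apply: (capN y) => //.
  + by rewrite yE enormN Dr.
  + rewrite (_ : _ - _ = - ((2 * r) *: v + r *: n)) ?enormN//; vring.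
  + rewrite yE dot3Nr dot3Nl opprK dot3Dl dot3Zl dnn.
    by have := dnle _ hy'; rewrite ler_norml => /andP[]; lra.
  + rewrite (_ : _ - _ = - ((2 * r) *: v + r *: n)); last by vring.
    by rewrite dot3Nr dot3Nl opprK dot3Dl !dot3Zl dnn (dot3C v); nra.
Qed.

End two_sided.

(** * Dyadic scales and curvature of perturbed tetrahedra *)

Section scales.
Context {R : realType}.
Implicit Types (U : set 'rV[R]_3) (x y v n : 'rV[R]_3) (r : R).

Lemma cos_pi4_sq : cos (pi / 4) ^+ 2 = 2^-1 :> R.
Proof.
have := @cos_mulr2n R (pi / 4).
rewrite (_ : pi / 4 *+ 2 = pi / 2); last by rewrite mulr2n; field.
rewrite cos_pihalf mulr2n => h; lra.
Qed.

(** The ball of radius r about 2rv is seen from the origin under the half-angle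
    pi / 6, which is less than pi / 4. *)
Lemma ball_in_cone v u r : enorm v = 1 -> 0 < r ->
  enorm (u - (2 * r) *: v) <= r ->
  [/\ u != 0, enorm u <= 3 * r & enorm u * cos (pi / 4) <= dot3 u v].
Proof.
move=> nv r0 h.
have vv : dot3 v v = 1 by rewrite -enorm_sq nv expr1n.
have h2 : dot3 u u - 4 * r * dot3 u v + 4 * r ^+ 2 <= r ^+ 2.
  have : enorm (u - (2 * r) *: v) ^+ 2 <= r ^+ 2.
    by rewrite ler_pXn2r// nnegrE ?enorm_ge0// ltW.
  rewrite enorm_sq !(dot3Bl, dot3Dr, dot3Nr, dot3Zl, dot3Zr) vv (dot3C v u); nra.
have m0 : 0 <= dot3 u v by have := dot3_ge0 u; nra.
split.
- apply: contraTneq h => ->; rewrite -ltNge sub0r enormN enormZ nv mulr1.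
  by rewrite ger0_norm ?mulr_ge0 ?ltW//; lra.
- have := enormD (u - (2 * r) *: v) ((2 * r) *: v).
  rewrite subrK enormZ nv mulr1 ger0_norm; last by rewrite mulr_ge0// ltW.
  by move=> h3; lra.
- rewrite (le_trans (ler_norm _))// -(@ler_pXn2r _ 2) ?nnegrE//.
  rewrite real_normK ?num_real// exprMn cos_pi4_sq enorm_sq.
  have := sqr_ge0 (dot3 u v - r); have := sqr_ge0 r; nra.
Qed.

(** The balls on the axis of a double cone whose radius is half the distance of
    their centre to the apex are contained in the nappes. *)
Lemma two_sided_small Sigma U : dense_cone_condition Sigma U ->
  exists2 S', Sigma `<=` closure S' & (S' `<=` Sigma /\ forall x, S' x ->
    exists2 rho : R, 0 < rho & forall r, 0 < r -> r <= rho -> two_sided U x r).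
Proof.
move=> [S' [S'S SS' h]]; exists S' => //; split => // x /h[v [d [nv d0 hp hn]]].
exists (d / 3); first by rewrite divr_gt0.
move=> r r0; rewrite ler_pdivlMr// => rd; exists v.
split => // y; rewrite /eball /= => hy.
- have [u0 u3 uc] : [/\ y - x != 0, enorm (y - x) <= 3 * r &
      enorm (y - x) * cos (pi / 4) <= dot3 (y - x) v].
    apply: ball_in_cone => //; rewrite (_ : _ - _ = y - (x + (2 * r) *: v))//.
    by vring.
  case: (hp y) => //; last by move=> /= yx; rewrite yx subrr eqxx in u0.
  split; first by rewrite /eball /=; lra.
  by exists (y - x) => //; vring.
- have [u0 u3 uc] : [/\ x - y != 0, enorm (x - y) <= 3 * r &
      enorm (x - y) * cos (pi / 4) <= dot3 (x - y) v].
    apply: ball_in_cone => //.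
    rewrite (_ : _ - _ = - (y - (x - (2 * r) *: v))) ?enormN//.
    by vring.
  case: (hn y) => //.
  + split; first by rewrite /eball /= enorm_sym; lra.
    exists (y - x); last by vring.
    by rewrite /cone_neg /= -dot3Nl opprB enorm_sym.
  + by move=> nU /subset_closure.
  + by move=> /= yx; rewrite yx subrr eqxx in u0.
Qed.

Lemma bounded_enorm U : bounded_set U ->
  exists2 M : R, 0 < M & forall y, U y -> enorm y <= M.
Proof.
move=> [M [_ hM]]; pose N := Num.max M 0 + 1.
have N0 : 0 < N by rewrite ltr_wpDl// le_max lexx orbT.
have MN : M < N by rewrite ltr_pwDr// le_max lexx.
exists (2 * N); first by rewrite mulr_gt0.
by move=> y Uy; rewrite (le_trans (enorm_le_norm _))// ler_wpM2l// hM.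
Qed.

(** A bounded set contains no large ball. *)
Lemma two_sided_large U : bounded_set U ->
  exists2 M : R, 0 < M & forall x r, M <= r -> ~ two_sided U x r.
Proof.
move=> /bounded_enorm[M M0 hM]; exists (M + 1); first by rewrite addr_gt0.
move=> x r Mr [v [nv Uv _]].
have r0 : 0 <= r by rewrite (le_trans _ Mr)// addr_ge0// ltW.
have h a : `|a| <= r -> enorm (x + (2 * r) *: v + a *: v) <= M.
  move=> ha; apply/hM/Uv; rewrite /eball /= (_ : _ - _ = a *: v); last by vring.
  by rewrite enormZ nv mulr1.
have h1 : enorm (x + (2 * r) *: v + r *: v) <= M by rewrite h// ger0_norm.
have h2 : enorm (x + (2 * r) *: v + (- r) *: v) <= M by rewrite h// normrN ger0_norm.
have := enormD (x + (2 * r) *: v + r *: v) (- (x + (2 * r) *: v + (- r) *: v)).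
rewrite enormN (_ : _ - _ = (2 * r) *: v); last by vring.
by rewrite enormZ nv mulr1 ger0_norm ?mulr_ge0//; lra.
Qed.

Lemma boundary_nonempty U : U !=set0 -> open U -> bounded_set U ->
  boundary U !=set0.
Proof.
move=> [y Uy] oU /bounded_enorm[M M0 hM].
have nU : ~ U (const_mx (2 * M)).
  move=> /hM; have := norm_le_enorm (const_mx (2 * M) : 'rV[R]_3).
  rewrite (_ : `|_| = mx_norm (const_mx (2 * M) : 'rV[R]_3))// mx_normrE => h1 h2.
  have := le_trans (le_bigmax 0 (fun i : 'I_1 * 'I_3 =>
    `|(const_mx (2 * M) : 'rV[R]_3) i.1 i.2|) (ord0, ord0)) (le_trans h1 h2).
  rewrite mxE => h3; have := le_trans (ler_norm _) h3; lra.
by have [t _ bt] := segment_boundary oU Uy nU; eexists; exact: bt.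
Qed.

Lemma closed_boundary U : closed (boundary U).
Proof.
by rewrite /boundary setDE; apply: closedI; [exact: closed_closure|
  apply: open_closedC; exact: open_interior].
Qed.

Lemma closed_eball x r : closed (eball x r).
Proof.
move=> y hy; rewrite /eball /=; apply/ler_addgt0Pr => e e0.
have [z] := closure_eball e0 hy.
rewrite /eball /= => zx zy; have := enorm_tri y x z; rewrite (enorm_sym y z); lra.
Qed.

Definition dyadic_scale (M : R) (k : nat) : R := M / 2 ^+ k.

Lemma dyadic_scale_gt0 M k : 0 < M -> 0 < dyadic_scale M k.
Proof. by move=> M0; rewrite divr_gt0// exprn_gt0. Qed.

Lemma dyadic_scaleD M j k : dyadic_scale M (j + k) = dyadic_scale M j / 2 ^+ k.
Proof. by rewrite /dyadic_scale exprD invfM mulrA. Qed.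

Lemma dyadic_scaleS M k : dyadic_scale M k = 2 * dyadic_scale M k.+1.
Proof. by rewrite -(addn1 k) dyadic_scaleD expr1; field. Qed.

Lemma le_dyadic_scale M j k : 0 <= M -> (j <= k)%N ->
  dyadic_scale M k <= dyadic_scale M j.
Proof.
by move=> M0 jk; rewrite ler_wpM2l// lef_pV2 ?posrE ?exprn_gt0// ler_weXn2l// ler1n.
Qed.

(** Larger indices are smaller scales: this is the first failure that is met
    when zooming out from x. *)
Definition last_bad_scale U x M k :=
  ~ two_sided U x (dyadic_scale M k) /\
  forall j, (k < j)%N -> two_sided U x (dyadic_scale M j).

Lemma last_bad_scale_exists U x (M rho : R) : 0 < M -> 0 < rho ->
  (forall r, 0 < r -> r <= rho -> two_sided U x r) ->
  ~ two_sided U x (dyadic_scale M 0) -> exists k, last_bad_scale U x M k.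
Proof.
move=> M0 rho0 small large.
have [N hN] : exists N, dyadic_scale M N <= rho.
  have [N hN] : exists N, N.+1%:R^-1 < rho / M.
    near \oo => n; exists n; near: n.
    exact: near_infty_natSinv_lt (PosNum (divr_gt0 rho0 M0)).
  exists N; rewrite /dyadic_scale mulrC -ler_pdivlMr// (le_trans _ (ltW hN))//.
  by rewrite lef_pV2 ?posrE ?exprn_gt0// -natrX ler_nat ltn_expl.
have [] := @ex_maxnP (fun k => `[< ~ two_sided U x (dyadic_scale M k) >]) N.
- by exists 0%N; apply/asboolP.
- move=> k /asboolP nk; rewrite leqNgt; apply/negP => Nk; apply: nk; apply: small.
    exact: dyadic_scale_gt0.
  by apply: le_trans hN; apply: le_dyadic_scale; [exact: ltW|exact: ltnW].
- move=> k /asboolP nk kmax; exists k; split => // j kj; apply: contrapT => nj.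
  by have := kmax j; rewrite leqNgt kj => /(_ _)/negP; apply; [apply/asboolP|].
Unshelve. all: by end_near. Qed.

End scales.

Section curvature.
Context {R : realType}.
Implicit Types (x y : 'rV[R]_3) (r : R).

(** By multilinearity the determinant changes by less than r^3 / 2, so it keeps
    half of its size; all edges have length at most 14r, so each face has area
    at most 98 r^2. *)
Lemma menger_curvature_ge x0 x1 x2 x3 y0 y1 y2 y3 r : 0 < r ->
  enorm (x1 - x0) <= 6 * r -> enorm (x2 - x0) <= 6 * r ->
  enorm (x3 - x0) <= 6 * r -> r ^+ 3 <= `|det3 (x1 - x0) (x2 - x0) (x3 - x0)| ->
  enorm (y0 - x0) <= r / 512 -> enorm (y1 - x1) <= r / 512 ->
  enorm (y2 - x2) <= r / 512 -> enorm (y3 - x3) <= r / 512 ->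
  1 / (100 ^+ 3 * r) <= menger_curvature y0 y1 y2 y3.
Proof.
move=> r0 x1r x2r x3r xd y0r y1r y2r y3r; have rge0 := ltW r0.
have dif a b c d : enorm (c - a) <= r / 512 -> enorm (d - b) <= r / 512 ->
    enorm ((c - d) - (a - b)) <= r / 256.
  move=> h1 h2; rewrite (_ : _ - _ = (c - a) - (d - b)); last by vring.
  by rewrite (le_trans (enormD _ _))// enormN; lra.
have len a c : enorm a <= 6 * r -> enorm (c - a) <= r / 256 -> enorm c <= 7 * r.
  by move=> h1 h2; have := enormD (c - a) a; rewrite subrK; lra.
have d1 := dif _ _ _ _ y1r y0r; have d2 := dif _ _ _ _ y2r y0r.
have d3 := dif _ _ _ _ y3r y0r.
have l1 := len _ _ x1r d1; have l2 := len _ _ x2r d2.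
have l3 := len _ _ x3r d3.
have mul3 (a b c A B C : R) : 0 <= a -> 0 <= b -> 0 <= c ->
    a <= A -> b <= B -> c <= C ->
    a * b * c <= A * B * C.
  by move=> a0 b0 c0 aA bB cC; rewrite ler_pM ?mulr_ge0// ler_pM.
have det_ge : r ^+ 3 / 2 <= `|det3 (y1 - y0) (y2 - y0) (y3 - y0)|.
  have h : `|det3 (y1 - y0) (y2 - y0) (y3 - y0)
      - det3 (x1 - x0) (x2 - x0) (x3 - x0)| <= r ^+ 3 / 2.
    rewrite det3_perturb.
    apply: le_trans (ler_normD _ _) _.
    apply: le_trans (lerD (ler_normD _ _) (lexx _)) _.
    apply: le_trans (lerD (lerD (det3_le _ _ _) (det3_le _ _ _)) (det3_le _ _ _)) _.
    have p1 := mul3 _ _ _ _ _ _ (enorm_ge0 _) (enorm_ge0 _) (enorm_ge0 _) d1 l2 l3.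
    have p2 := mul3 _ _ _ _ _ _ (enorm_ge0 _) (enorm_ge0 _) (enorm_ge0 _) x1r d2 l3.
    have p3 := mul3 _ _ _ _ _ _ (enorm_ge0 _) (enorm_ge0 _) (enorm_ge0 _) x1r x2r d3.
    apply: le_trans (lerD (lerD p1 p2) p3) _.
    have r3 : 0 <= r ^+ 3 by rewrite exprn_ge0.
    (* 49 + 42 + 36 = 127, and each term carries one displacement r / 256. *)
    rewrite [leLHS](_ : _ = r ^+ 3 * (127 / 256)); last by field.
    by lra.
  have := lerB_normD (det3 (x1 - x0) (x2 - x0) (x3 - x0))
    (det3 (y1 - y0) (y2 - y0) (y3 - y0) - det3 (x1 - x0) (x2 - x0) (x3 - x0)).
  by rewrite addrCA subrr addr0; lra.
have r3 : 0 < r ^+ 3 by rewrite exprn_gt0.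
have det_neq0 : det3 (y1 - y0) (y2 - y0) (y3 - y0) != 0.
  by rewrite -normr_gt0; lra.
have dist a b : enorm (a - y0) <= 7 * r -> enorm (b - y0) <= 7 * r ->
    enorm (a - b) <= 14 * r.
  by move=> h1 h2; have := enorm_tri a b y0; rewrite (enorm_sym y0 b); lra.
have l0 : enorm (y0 - y0) <= 7 * r by rewrite subrr enorm0 mulr_ge0.
have area_ge0 (a b c : 'rV[R]_3) : 0 <= triangle_area a b c.
  by rewrite divr_ge0// enorm_ge0.
have area_le a b c : enorm (a - y0) <= 7 * r -> enorm (b - y0) <= 7 * r ->
    enorm (c - y0) <= 7 * r -> triangle_area a b c <= 98 * r ^+ 2.
  move=> h1 h2 h3; rewrite /triangle_area ler_pdivrMr//.
  apply: le_trans (enorm_cross _ _) _.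
  have := ler_pM (enorm_ge0 _) (enorm_ge0 _) (dist _ _ h2 h1) (dist _ _ h3 h1).
  by move/le_trans; apply; rewrite [leLHS](_ : _ = 98 * r ^+ 2 * 2)//; ring.
have cross_neq0 : 0 < enorm (cross3 (y1 - y0) (y2 - y0)).
  rewrite lt_neqAle enorm_ge0 andbT eq_sym; apply: contraNneq det_neq0.
  by move=> /enorm0_eq0 c0; rewrite /det3 c0 dot3C dot30l.
have A0 : 0 < tetra_area y0 y1 y2 y3.
  have t0 : 0 < triangle_area y0 y1 y2 by exact: divr_gt0.
  have := area_ge0 y0 y1 y3; have := area_ge0 y0 y2 y3; have := area_ge0 y1 y2 y3.
  by rewrite /tetra_area; lra.
have A1 : tetra_area y0 y1 y2 y3 <= 392 * r ^+ 2.
  have := area_le y0 y1 y2 l0 l1 l2; have := area_le y0 y1 y3 l0 l1 l3.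
  have := area_le y0 y2 y3 l0 l2 l3; have := area_le y1 y2 y3 l1 l2 l3.
  by rewrite /tetra_area; lra.
have diam_le14 : (diam [set y0; y1; y2; y3] <= (14 * r)%:E)%E.
  apply: diam_le; first by rewrite mulr_ge0.
  by move=> a b [[[]|]|] -> [[[]|]|] ->; apply: dist.
have dfin : diam [set y0; y1; y2; y3] \is a fin_num.
  by rewrite ge0_fin_numE ?diam_ge0// (le_lt_trans diam_le14)// ltry.
have D1 : tetra_diam y0 y1 y2 y3 <= 14 * r.
  by rewrite -lee_fin /tetra_diam fineK.
have D0 : 0 < tetra_diam y0 y1 y2 y3.
  apply: (@lt_le_trans _ _ (enorm (y1 - y0))).
    rewrite lt_neqAle enorm_ge0 andbT eq_sym; apply: contraNneq det_neq0 => e0.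
    have := det3_le (y1 - y0) (y2 - y0) (y3 - y0).
    by rewrite e0 !mul0r normr_le0.
  by rewrite -lee_fin /tetra_diam fineK//; apply: diam_ub; rewrite /=; tauto.
rewrite /menger_curvature; case: asboolP => [[n [c [n0 [c0 c1 c2 c3]]]]|_].
  exfalso; move/eqP: n0; apply; apply: det3_coplanar det_neq0;
    by rewrite dot3C dot3Bl !(dot3C _ n) ?c0 ?c1 ?c2 ?c3 subrr.
rewrite ler_pdivlMr ?mulr_gt0 ?exprn_gt0//.
rewrite mul1r mulrC ler_pdivrMr ?mulr_gt0//.
have D2 : tetra_diam y0 y1 y2 y3 ^+ 2 <= (14 * r) ^+ 2.
  by rewrite ler_pXn2r// ?nnegrE ?mulr_ge0// ltW.
apply: le_trans (ler_pM (ltW A0) (sqr_ge0 _) A1 D2) _.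
rewrite /tetra_volume -/(det3 (y1 - y0) (y2 - y0) (y3 - y0)).
have := ler_wpM2r rge0 det_ge.
set X := `|_|; rewrite [leLHS](_ : _ = r ^+ 4 / 2); last by field.
rewrite [leLHS in _ -> leLHS <= _](_ : _ = (392 * 196) * r ^+ 4); last by ring.
rewrite [leRHS in _ -> _ <= leRHS](_ : _ = (100 ^+ 3 / 6) * (X * r)); last by field.
by have := exprn_gt0 4 r0; lra.
Qed.

End curvature.

(** * Lower bounds for the iterated integral *)

Section lower_integral.
Context d (T : measurableType d) (R : realType).
Variable mu : {measure set T -> \bar R}.
Local Open Scope ereal_scope.

(** The integral of a nonnegative function is the supremum of the integrals of
    the simple functions below it, which makes it monotone whether or not the
    functions are measurable. The inner integrals of the Menger energy can thus
    be bounded below as functions of the outer variables. *)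
Lemma ge0_integral_mono (D : set T) (f g : T -> \bar R) :
  (forall x, D x -> 0 <= f x) -> (forall x, D x -> f x <= g x) ->
  \int[mu]_(x in D) f x <= \int[mu]_(x in D) g x.
Proof.
move=> f0 fg; have g0 x : D x -> 0 <= g x.
  by move=> Dx; apply: le_trans (fg _ Dx); exact: f0.
rewrite !ge0_integralE//; apply: ge_ereal_sup => _ [h /= hf <-].
apply: ereal_sup_ubound; exists h => //= x; apply: le_trans (hf x) _; rewrite /patch.
by case: ifPn => // /set_mem; exact: fg.
Qed.

Lemma integral_ge_sum (D : set T) (f : T -> \bar R) (N : nat)
    (A : nat -> set T) (a m : nat -> R) : measurable D ->
  (forall k, measurable (A k)) -> (forall k, A k `<=` D) ->
  (forall k, (0 <= a k)%R) -> (forall k, (k < N)%N -> (m k)%:E <= mu (A k)) ->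
  (forall x, D x -> (\sum_(k < N) a k * \1_(A k) x)%R%:E <= f x) ->
  (\sum_(k < N) a k * m k)%R%:E <= \int[mu]_(x in D) f x.
Proof.
move=> mD mA AD a0 mmu hf.
have h0 k x : (0 <= a k * \1_(A k) x)%R by rewrite mulr_ge0// indicE.
apply: le_trans (ge0_integral_mono _ hf); last first.
  by move=> x _; rewrite lee_fin sumr_ge0.
under eq_integral do rewrite -sumEFin.
rewrite ge0_integral_sum//; last 2 first.
- move=> k; apply/measurable_EFinP.
  apply: measurable_funM; first exact: measurable_cst.
  exact: measurable_indic.
- by move=> k x _; rewrite lee_fin.
rewrite -sumEFin; apply: lee_sum => k _.
under eq_integral do rewrite EFinM.
rewrite ge0_integralZl//; last 2 first.
- by apply/measurable_EFinP; exact: measurable_indic.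
- by rewrite lee_fin.
rewrite integral_indic// (setIidl (AD _)) EFinM lee_wpmul2l ?lee_fin//.
exact: mmu.
Qed.

End lower_integral.

Section menger_integral.
Context {R : realType}.

(** The selected terms grow at least geometrically, so their sum is at most twice
    the last of them. This replaces disjointness of the sets of tetrahedra found
    at different scales. *)
Lemma sum_geometric (a : nat -> R) (b : nat -> bool) (F : R) N :
  (forall k, 0 <= a k) -> (forall k, a k *+ 2 <= a k.+1) -> 0 <= F ->
  (forall k, (k < N)%N -> b k -> a k <= F) ->
  \sum_(k < N) a k * (b k)%:R <= F *+ 2.
Proof.
move=> a0 a2 F0.
have aux n : \sum_(k < n) a k * (b k)%:R <= a n.
  elim: n => [|n IH]; first by rewrite big_ord0.
  rewrite big_ord_recr /=; apply: le_trans (a2 n); rewrite mulr2n lerD//.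
  by case: (b n); rewrite ?mulr1// mulr0.
elim: N => [|n IH] bF; first by rewrite big_ord0 mulrn_wge0.
rewrite big_ord_recr /=; case bn : (b n).
  by rewrite mulr1 mulr2n lerD ?(le_trans (aux n))// bF.
by rewrite mulr0 addr0; apply: IH => k kn; apply: bF; exact: ltnW.
Qed.

(** The radius r / 512 is the displacement of the vertices that
    [menger_curvature_ge] tolerates, and m is a lower bound for the density of
    Sigma at that scale, so that four pieces of Sigma of area m r^2 support
    tetrahedra of curvature comparable to 1 / r. *)
Definition fat_tetrahedron (m : R) (Sigma : set 'rV[R]_3) (r : R)
    (X : 'I_4 -> 'rV[R]_3) : Prop :=
  [/\ forall i, enorm (X i - X ord0) <= 6 * r,
      r ^+ 3 <= `|det3 (X (inord 1) - X ord0) (X (inord 2) - X ord0)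
                    (X (inord 3) - X ord0)|
    & forall i, ((m * r ^+ 2)%:E <= hausdorff2 (Sigma `&` eball (X i) (r / 512)))%E].

(** The k-th tetrahedron contributes (100^3 r_k)^(-8), the eighth power of the
    curvature, times (m r_k^2)^4, the measure of its four pieces of Sigma; the
    powers of r_k cancel. The factor 1 / 2 pays for the overlap of the pieces at
    different scales, see [sum_geometric]. *)
Lemma integral_menger_ge (Sigma : set 'rV[R]_3) (m : R) (N : nat)
    (r : nat -> R) (X : nat -> 'I_4 -> 'rV[R]_3) :
  closed Sigma -> 0 <= m -> (forall k, 0 < r k) -> (forall k, r k.+1 *+ 2 <= r k) ->
  (forall k, (k < N)%N -> fat_tetrahedron m Sigma (r k) (X k)) ->
  ((N%:R * (m ^+ 4 / (2 * 100 ^+ 24)))%:E <= integral_menger 8 Sigma)%E.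
Proof.
move=> cS m0 r0 r2 fat.
have cl (A : set 'rV[R]_3) : closed A -> measurable (A : set (R3_H2 R)).
  by move=> cA; exact: closed_caratheodory.
have mS := cl _ cS.
pose A i k : set (R3_H2 R) := Sigma `&` eball (X k i) (r k / 512).
have mA i k : measurable (A i k).
  by apply: cl; apply: closedI => //; exact: closed_eball.
have AS i k : A i k `<=` Sigma by exact: subIsetl.
pose c k : R := ((100 ^+ 3 * r k)^-1) ^+ 8.
have C0 : 0 < 100 ^+ 3 :> R by rewrite exprn_gt0.
have c0 k : 0 <= c k by rewrite exprn_ge0// invr_ge0 mulr_ge0// ltW.
have c2 k : c k *+ 2 <= c k.+1.
  pose z : R := (100 ^+ 3 * r k)^-1.
  have z0 : 0 <= z by rewrite invr_ge0 mulr_ge0// ltW.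
  have hz : 2 * z <= (100 ^+ 3 * r k.+1)^-1.
    rewrite -[2]invrK /z -invfM lef_pV2 ?posrE ?mulr_gt0 ?invr_gt0//.
    rewrite mulrCA ler_pM2l// mulrC ler_pdivlMr//.
    by rewrite mulr_natr.
  apply: (@le_trans _ _ ((2 * z) ^+ 8)); last first.
    by rewrite lerXn2r// nnegrE ?mulr_ge0 ?(le_trans _ hz) ?mulr_ge0.
  by rewrite exprMn /c -/z mulr2n; have := exprn_ge0 8 z0; lra.
pose M k := m * r k ^+ 2.
have hM i k : (k < N)%N -> ((M k)%:E <= hausdorff2_measure R (A i k))%E.
  by move=> kN; have [_ _] := fat _ kN; exact.
have pointwise x0 x1 x2 x3 :
  \sum_(k < N) (c k / 2 * \1_(A (inord 3) k) x3 * \1_(A (inord 2) k) x2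
     * \1_(A (inord 1) k) x1) * \1_(A ord0 k) x0
  <= menger_curvature x0 x1 x2 x3 `^ 8.
  set F := _ `^ 8.
  rewrite -(ler_pM2r (ltr0n R 2)) [leRHS]mulr_natr.
  pose b k := [&& x3 \in A (inord 3) k, x2 \in A (inord 2) k,
    x1 \in A (inord 1) k & x0 \in A ord0 k].
  rewrite big_distrl /= (eq_bigr (fun k : 'I_N => c k * (b k)%:R)); last first.
    by move=> k _; rewrite !indicE /b -!mulnb !natrM; field.
  apply: (@sum_geometric c b) => //; first exact: powR_ge0.
  move=> k kN /and4P[].
  move=> /set_mem[_ y3] /set_mem[_ y2] /set_mem[_ y1] /set_mem[_ y0].
  have [X6 Xd _] := fat _ kN.
  have := menger_curvature_ge (r0 k) (X6 _) (X6 _) (X6 _) Xd y0 y1 y2 y3.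
  rewrite div1r => K_ge; rewrite /F /c -(@powR_mulrn _ _ 8); last first.
    by rewrite invr_ge0 mulr_ge0// ltW.
  apply: ge0_ler_powR => //; rewrite nnegrE.
    by rewrite invr_ge0 mulr_ge0// ltW.
  by apply: le_trans K_ge; rewrite invr_ge0 mulr_ge0// ltW.
have hc k : 0 <= c k / 2 by rewrite divr_ge0.
have sumE : N%:R * (m ^+ 4 / (2 * 100 ^+ 24)) =
    \sum_(k < N) c k / 2 * M k * M k * M k * M k.
  rewrite (eq_bigr (fun=> m ^+ 4 / (2 * 100 ^+ 24))).
    by rewrite sumr_const card_ord mulr_natl.
  move=> k _; rewrite /c /M; have := r0 k; move: (r k) => s s0.
  rewrite (_ : 100 ^+ 24 = (100 ^+ 3) ^+ 8); last by rewrite -exprM.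
  by move: (100 ^+ 3) C0 => C C0; field; rewrite !gt_eqF.
rewrite sumE /integral_menger.
have ind0' (B : set (R3_H2 R)) x : 0 <= \1_B x :> R by rewrite indicE.
have M0 k : 0 <= M k by rewrite mulr_ge0// sqr_ge0.
apply: (@integral_ge_sum _ (R3_H2 R) R (hausdorff2_measure R) _ _ _
  (A (inord 3)) (fun k => c k / 2 * M k * M k * M k) M) => //.
- by move=> k; do ?[exact: hc|exact: M0|exact: ind0'|apply: mulr_ge0].
- by move=> k; exact: hM.
move=> x3 _; rewrite (eq_bigr (fun k : 'I_N =>
  c k / 2 * \1_(A (inord 3) k) x3 * M k * M k * M k)); last by move=> k _; ring.
apply: (@integral_ge_sum _ (R3_H2 R) R (hausdorff2_measure R) _ _ _
  (A (inord 2)) (fun k => c k / 2 * \1_(A (inord 3) k) x3 * M k * M k) M) => //.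
- by move=> k; do ?[exact: hc|exact: M0|exact: ind0'|apply: mulr_ge0].
- by move=> k; exact: hM.
move=> x2 _; rewrite (eq_bigr (fun k : 'I_N => c k / 2 * \1_(A (inord 3) k) x3
  * \1_(A (inord 2) k) x2 * M k * M k)); last by move=> k _; ring.
apply: (@integral_ge_sum _ (R3_H2 R) R (hausdorff2_measure R) _ _ _
  (A (inord 1)) (fun k => c k / 2 * \1_(A (inord 3) k) x3 * \1_(A (inord 2) k) x2
     * M k) M) => //.
- by move=> k; do ?[exact: hc|exact: M0|exact: ind0'|apply: mulr_ge0].
- by move=> k; exact: hM.
move=> x1 _; rewrite (eq_bigr (fun k : 'I_N => c k / 2 * \1_(A (inord 3) k) x3
  * \1_(A (inord 2) k) x2 * \1_(A (inord 1) k) x1 * M k)); last by move=> k _; ring.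
apply: (@integral_ge_sum _ (R3_H2 R) R (hausdorff2_measure R) _ _ _
  (A ord0) (fun k => c k / 2 * \1_(A (inord 3) k) x3 * \1_(A (inord 2) k) x2
     * \1_(A (inord 1) k) x1) M) => //.
- by move=> k; do ?[exact: hc|exact: M0|exact: ind0'|apply: mulr_ge0].
- by move=> k; exact: hM.
by move=> x0 _; rewrite lee_fin pointwise.
Qed.

End menger_integral.

(** * The stopping scale and the conclusion *)

Section assembly.
Context {R : realType}.
Implicit Types (U Sigma S : set 'rV[R]_3) (x y : 'rV[R]_3) (M r m : R).

Definition quadruple x0 x1 x2 x3 : 'I_4 -> 'rV[R]_3 :=
  fun i => nth x0 [:: x0; x1; x2; x3] i.

Lemma quadrupleE x0 x1 x2 x3 : ((quadruple x0 x1 x2 x3 ord0 = x0) *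
  (quadruple x0 x1 x2 x3 (inord 1) = x1) * (quadruple x0 x1 x2 x3 (inord 2) = x2) *
  (quadruple x0 x1 x2 x3 (inord 3) = x3))%type.
Proof. by rewrite /quadruple !inordK. Qed.

Lemma last_bad_scale_tetrahedron U x M k : open U -> 0 < M -> boundary U x ->
  last_bad_scale U x M k ->
  exists X : 'I_4 -> 'rV[R]_3, let r := dyadic_scale M k.+1 in
  [/\ forall i, boundary U (X i), forall i, enorm (X i - X ord0) <= 6 * r &
    r ^+ 3 <= `|det3 (X (inord 1) - X ord0) (X (inord 2) - X ord0)
                    (X (inord 3) - X ord0)|].
Proof.
move=> oU M0 Sx [nk kS]; have r0 := dyadic_scale_gt0 k.+1 M0.
rewrite dyadic_scaleS in nk.
have [x1 [x2 [x3 [b1 b2 b3 [h1 h2 h3] hd]]]] :=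
  voluminous_tetrahedron oU r0 (kS _ (ltnSn k)) nk.
exists (quadruple x x1 x2 x3); rewrite /= !quadrupleE; split => //.
  by case=> [[|[|[|[|//]]]] ?].
by case=> [[|[|[|[|//]]]] ?] //=; rewrite /quadruple /= subrr enorm0 mulr_ge0// ltW.
Qed.

(** At each vertex take a cone point at distance at most s = r / 2^11; it is
    two-sided at scale s, and the ball of radius 3s about it is contained in
    that of radius 4s = r / 512 about the vertex. *)
Lemma fat_of_smallest_scale Sigma U S x M k : open U -> 0 < M -> Sigma = boundary U ->
  S `<=` Sigma -> Sigma `<=` closure S -> S x -> last_bad_scale U x M k ->
  (forall y j, S y -> (k < j)%N -> two_sided U y (dyadic_scale M j)) ->
  exists X, fat_tetrahedron (32 * (2 ^+ 11) ^+ 2)^-1 Sigma (dyadic_scale M k.+1) X.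
Proof.
move=> oU M0 SE SS Scl Sx xk all.
have [|X [bX X6 Xd]] := last_bad_scale_tetrahedron oU M0 _ xk.
  by rewrite -SE; exact: SS.
exists X; split => // i; set r := dyadic_scale M k.+1.
have r0 : 0 < r := dyadic_scale_gt0 k.+1 M0.
pose s := dyadic_scale M (k.+1 + 11); have s0 : 0 < s := dyadic_scale_gt0 _ M0.
have sE : s = r / 2 ^+ 11 by rewrite /s dyadic_scaleD.
have [|y Sy yX] := closure_eball (x := X i) s0 (A := S).
  by apply: Scl; rewrite SE.
have Ty : two_sided U y s by apply: all => //; rewrite ltnS leq_addr.
have := two_sided_mass oU s0 Ty; rewrite -SE => mass.
apply: le_trans (le_trans mass _); last first.
  apply: le_hausdorff2 => z [Sz]; rewrite /eball /= => zy; split => //.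
  have := enorm_tri z (X i) y; rewrite /eball /= (_ : r / 512 = 4 * s); first by lra.
  by rewrite sE; field.
by rewrite lee_fin sE le_eqVlt; apply/orP; left; apply/eqP; field.
Qed.

(** The lower area bound applies up to the diameter of Sigma, which is at least
    r / 36: the edges are at most 6r and their determinant is at least r^3. *)
Lemma fat_of_ahlfors Sigma U x M k (K : R) : open U -> 0 < M -> 0 < K ->
  Sigma = boundary U -> Sigma x -> last_bad_scale U x M k ->
  (forall x r, Sigma x -> 0 < r -> (r%:E <= diam Sigma)%E ->
      ((K^-1 * r ^+ 2)%:E <= hausdorff2 (Sigma `&` eball x r) < +oo)%E) ->
  exists X, fat_tetrahedron (K^-1 / 512 ^+ 2) Sigma (dyadic_scale M k.+1) X.
Proof.
move=> oU M0 K0 SE Sx xk HK.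
have [|X [bX X6 Xd]] := last_bad_scale_tetrahedron oU M0 _ xk; first by rewrite -SE.
exists X; split => // i; set r := dyadic_scale M k.+1.
have r0 : 0 < r := dyadic_scale_gt0 k.+1 M0.
have rdiam : ((r / 512)%:E <= diam Sigma)%E.
  have d1 : ((enorm (X (inord 1) - X ord0))%:E <= diam Sigma)%E.
    by apply: diam_ub; rewrite SE.
  apply: le_trans d1; rewrite lee_fin -/r in Xd *.
  have := le_trans Xd (det3_le _ _ _).
  have h1 := X6 (inord 2); have h2 := X6 (inord 3).
  set a := enorm _; set b := enorm _; set c := enorm _ => h.
  have bc : b * c <= (6 * r) * (6 * r) by rewrite ler_pM ?enorm_ge0.
  have a0 : 0 <= a := enorm_ge0 _.
  have : r ^+ 3 <= 36 * a * r ^+ 2.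
    apply: le_trans h _; rewrite -mulrA.
    apply: le_trans (ler_wpM2l a0 bc) _.
    by rewrite [leLHS](_ : _ = 36 * a * r ^+ 2)//; ring.
  rewrite exprS ler_pM2r ?exprn_gt0//; lra.
have SXi : Sigma (X i) by rewrite SE.
have r512 : 0 < r / 512 by rewrite divr_gt0.
have /andP[h _] := HK _ _ SXi r512 rdiam.
apply: le_trans h; rewrite lee_fin le_eqVlt; apply/orP; left; apply/eqP; field.
by rewrite gt_eqF.
Qed.

(** Choose the tetrahedra one after the other, each with a larger index, that is
    at most half the scale, of the one before. *)
Lemma halving_tetrahedra Sigma M m : 0 < M ->
  (forall n, exists k, (n <= k)%N /\
    exists X, fat_tetrahedron m Sigma (dyadic_scale M k.+1) X) ->
  exists (r : nat -> R) (X : nat -> 'I_4 -> 'rV[R]_3),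
  [/\ forall k, 0 < r k, forall k, r k.+1 *+ 2 <= r k &
      forall k, fat_tetrahedron m Sigma (r k) (X k)].
Proof.
move=> M0 h.
have [G hG] : {G : nat -> nat * ('I_4 -> 'rV[R]_3) & forall n, (n <= (G n).1)%N /\
    fat_tetrahedron m Sigma (dyadic_scale M (G n).1.+1) (G n).2}.
  apply: (@choice _ _ (fun n g => (n <= g.1)%N /\
    fat_tetrahedron m Sigma (dyadic_scale M g.1.+1) g.2)) => n.
  by have [k [nk [X hX]]] := h n; exists (k, X).
pose idx := fix idx k := if k is k'.+1 then (G (idx k')).1.+1 else 0%N.
exists (fun k => dyadic_scale M (G (idx k)).1.+1), (fun k => (G (idx k)).2); split.
- by move=> k; exact: dyadic_scale_gt0.
- move=> k; rewrite [leRHS]dyadic_scaleS mulr_natl lerMn2r /=.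
  by apply: le_dyadic_scale; [exact: ltW|have [] := hG (idx k.+1)].
- by move=> k; have [] := hG (idx k).
Qed.

End assembly.

Theorem theorem3p2 (R : realType) :
  exists gamma0 : R, 0 < gamma0 /\
    forall Sigma : set 'rV[R]_3,
      admissible Sigma -> (gamma0%:E < integral_menger 8 Sigma)%E.
Proof.
pose m1 : R := (32 * (2 ^+ 11) ^+ 2)^-1.
pose g (m : R) := m ^+ 4 / (2 * 100 ^+ 24).
have g0 m : 0 < m -> 0 < g m.
  by move=> m0; rewrite divr_gt0 ?mulr_gt0 ?exprn_gt0.
have m10 : 0 < m1 by rewrite invr_gt0 mulr_gt0 ?exprn_gt0.
exists (g m1 / 2); split; first by rewrite divr_gt0// g0.
move=> Sigma [_ _ [U [[U0 oU _] bU SE [K K0 HK] dcc]]].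
have cS : closed Sigma by rewrite SE; exact: closed_boundary.
have [S Scl [SS small]] := two_sided_small dcc.
have [M M0 large] := two_sided_large bU.
have bad_scaleS x : S x -> exists k, last_bad_scale U x M k.
  move=> /small[rho rho0 hrho]; apply: last_bad_scale_exists M0 rho0 hrho _.
  by apply: large; rewrite /dyadic_scale divr1.
have Sneq0 : S !=set0.
  have [x bx] := boundary_nonempty U0 oU bU.
  have [|y Sy _] := closure_eball (x := x) (@ltr01 R) (A := S); last by exists y.
  by apply: Scl; rewrite SE.
(* Either the largest bad index is attained, or the bad indices are unbounded. *)
have [[x [k [Sx xk kmax]]]|nomax] := pselect (exists x k,
    [/\ S x, last_bad_scale U x M k &
    forall y j, S y -> last_bad_scale U y M j -> (j <= k)%N]).
- have all y j : S y -> (k < j)%N -> two_sided U y (dyadic_scale M j).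
    move=> Sy kj; have [i yi] := bad_scaleS _ Sy; apply: yi.2.
    by apply: leq_ltn_trans kj; exact: kmax yi.
  have [X hX] := fat_of_smallest_scale oU M0 SE SS Scl Sx xk all.
  have := @integral_menger_ge R Sigma m1 1
    (fun j => dyadic_scale M (k.+1 + j)) (fun=> X).
  rewrite mul1r => /(_ cS (ltW m10)) main.
  apply: lt_le_trans (main _ _ _).
  + by rewrite lte_fin -/(g m1) ltr_pdivrMr// ltr_pMr ?g0// ltr1n.
  + by move=> j; exact: dyadic_scale_gt0.
  + by move=> j; rewrite addnS [leRHS]dyadic_scaleS mulr_natl.
  + by case=> // _; rewrite addn0.
have unb n : exists x k, [/\ (n <= k)%N, S x & last_bad_scale U x M k].
  apply: contrapT => nb; apply: nomax; have [x0 Sx0] := Sneq0.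
  have [k0 hk0] := bad_scaleS _ Sx0.
  have [] := @ex_maxnP (fun k => `[< exists2 x, S x & last_bad_scale U x M k >]) n.
  - by exists k0; apply/asboolP; exists x0.
  - move=> k /asboolP[x Sx xk]; rewrite leqNgt; apply/negP => nk.
    by apply: nb; exists x, k; split => //; exact: ltnW.
  - move=> k /asboolP[x Sx xk] kmax; exists x, k; split => // y j Sy yj.
    by apply: kmax; apply/asboolP; exists y.
pose m2 := K^-1 / 512 ^+ 2.
have m20 : 0 < m2 by rewrite divr_gt0 ?invr_gt0 ?exprn_gt0.
have [|r [X [r0 r2 hX]]] := @halving_tetrahedra R Sigma M m2 M0.
  move=> n; have [x [k [nk Sx xk]]] := unb n; exists k; split => //.
  exact: fat_of_ahlfors oU M0 K0 SE (SS _ Sx) xk HK.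
have [N hN] : exists N : nat, g m1 / 2 < N%:R * g m2.
  exists (Num.bound (g m1 / 2 / g m2)); rewrite -ltr_pdivrMr ?g0//.
  by apply/archi_boundP/ltW/divr_gt0; [apply: divr_gt0 => //; exact: g0|exact: g0].
apply: lt_le_trans (integral_menger_ge cS (ltW m20) r0 r2
  (fun k (_ : (k < N)%N) => hX k)).
by rewrite lte_fin.
Qed.
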